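(* Let $\sigma\in\mathcal W$ be an arbitrary quasianalytic weight function. (1) If $\omega\in\mathcal W$ is quasianalytic and satisfies $\omega(t)=o(t)$ as $t\to+\infty$, then $j^\infty(\mathcal E^{0,r}_{\{\sigma\}})\cap\Lambda^r_{(\omega)}$ is meager and Haar-null in the Fréchet space $\Lambda^r_{(\omega)}$. (2) If $\omega\in\mathcal W$ is quasianalytic, satisfies $\omega(t)=O(t)$ as $t\to+\infty$, and $\liminf_{t\to+\infty}\omega(t)/t=0$, then $\Lambda^r_{\{\omega\}}\setminus j^\infty(\mathcal E^{0,r}_{\{\sigma\}})$ is dense in $\Lambda^r_{\{\omega\}}$ (and hence so is $\Lambda^r_{\{\omega\}}\setminus j^\infty(\mathcal E^{0,r}_{(\sigma)})$). (3) If $\omega\in\mathcal W$ is quasianalytic and satisfies $\omega(t)=O(t)$ and $\liminf_{t\to+\infty}\omega(t)/t=0$ (Roumieu case), resp. $\omega(t)=o(t)$ as $t\to+\infty$ (Beurling case), then $\Lambda^r_{[\omega]}\setminus j^\infty(\mathcal E^{0,r}_{\{\sigma\}})$ is lineable in $\Lambda^r_{[\omega]}$ (and hence so is $\Lambda^r_{[\omega]}\setminus j^\infty(\mathcal E^{0,r}_{(\sigma)})$).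
   Context: A weight function is a continuous increasing $\omega:[0,\infty)\to[0,\infty)$ with $\omega(t)=0$ for $t\in[0,1]$ and $\omega(t)\to+\infty$ as $t\to+\infty$. $\mathcal W$ is the set of weight functions $\omega$ such that $\omega(2t)=O(\omega(t))$ as $t\to\infty$, $\log t=o(\omega(t))$ as $t\to\infty$, and $\varphi_\omega(t):=\omega(e^t)$ is convex on $\mathbb R$. $\omega$ is quasianalytic if $\int_1^{\infty}\omega(t)/t^2\,dt=+\infty$. $\varphi^*_\omega(x):=\sup_{y\ge0}(xy-\varphi_\omega(y))$ for $x\ge0$. For $U\subseteq\mathbb R^r$ open, $K\subseteq U$ compact, $l>0$: $\|f\|^\omega_{K,l}:=\sup_{\alpha\in\mathbb N^r,x\in K}|\partial^\alpha f(x)|/\exp(\frac1l\varphi^*_\omega(l|\alpha|))$. $\mathcal E_{\{\omega\}}(U)$: smooth $f$ such that for every compact $K\subseteq U$ there exists $l>0$ with $\|f\|^\omega_{K,l}<\infty$; $\mathcal E_{(\omega)}(U)$: for every compact $K$ and every $l>0$. $\mathcal E^{0,r}_{\{\omega\}}$, $\mathcal E^{0,r}_{(\omega)}$ are the corresponding spaces of germs at $0\in\mathbb R^r$ (functions in the class on some cube $(-1/k,1/k)^r$). The sequence spaces are $\Lambda^r_{\{\omega\}}:=\{\mathbf b\in\mathbb C^{\mathbb N^r}:\exists l>0,\ \sup_\alpha|b_\alpha||\alpha|!/\exp(\frac1l\varphi^*_\omega(l|\alpha|))<\infty\}$ (an (LB)-space with the inductive limit topology) and $\Lambda^r_{(\omega)}$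 defined with ''for all $l>0$'' (a Fréchet space with these seminorms). The Borel map is $j^\infty(f)=(\partial^\alpha f(0)/|\alpha|!)_{\alpha\in\mathbb N^r}$. $[\cdot]$ means $\{\cdot\}$ throughout or $(\cdot)$ throughout. Meager: complement contains a countable intersection of dense open sets. Haar-null (in a complete metric vector space $X$): contained in a Borel set $B$ for which some compactly supported Borel probability measure $\mu$ satisfies $\mu(x+B)=0$ for all $x\in X$. Lineable: the set together with $0$ contains an infinite-dimensional vector subspace. *)

(* Defs.v *)
From HB Require Import structures.
From mathcomp Require Import all_boot all_order all_algebra.
From mathcomp Require Import all_classical all_reals all_analysis.
From mathcomp Require Import complex.

Unset Printing Implicit Defensive.

Import Order.TTheory GRing.Theory Num.Theory.
Import numFieldNormedType.Exports.

Local Open Scope classical_set_scope.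
Local Open Scope ring_scope.

(** weight function: continuous increasing w:[0,oo)->[0,oo), w = 0 on [0,1],
    w(t) -> +oo as t -> +oo  (only the values on [0,oo) matter) *)
Definition is_weight {R : realType} (w : R -> R) : Prop :=
  {within `[0%R, +oo[, continuous w} /\
  (forall x y : R, 0 <= x -> x <= y -> w x <= w y) /\
  (forall t : R, 0 <= t -> 0 <= w t) /\
  (forall t : R, 0 <= t -> t <= 1 -> w t = 0) /\
  (w t @[t --> +oo] --> +oo).

Definition in_W {R : realType} (w : R -> R) : Prop :=
  is_weight w /\
  (exists C T : R, forall t, T <= t -> w (2 * t) <= C * w t) /\
  (forall eps : R, 0 < eps -> exists T : R, forall t, T <= t -> `|ln t| <= eps * w t) /\
  (forall (x y l : R), 0 <= l -> l <= 1 ->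
     w (expR (l * x + (1 - l) * y)) <= l * w (expR x) + (1 - l) * w (expR y)).

Definition quasianalytic {R : realType} (w : R -> R) : Prop :=
  (\int[@lebesgue_measure R]_(t in `[1%R, +oo[) ((w t / t ^+ 2)%:E) = +oo)%E.

Definition small_o_id {R : realType} (w : R -> R) : Prop :=
  forall eps : R, 0 < eps -> exists T : R, forall t, T <= t -> `|w t| <= eps * t.
Definition big_O_id {R : realType} (w : R -> R) : Prop :=
  exists C T : R, forall t, T <= t -> `|w t| <= C * t.
Definition liminf_over_id_zero {R : realType} (w : R -> R) : Prop :=
  (* liminf_{t->+oo} w(t)/t = 0  (w >= 0 on [0,oo), so the liminf is >= 0) *)
  forall eps T : R, 0 < eps -> exists t, T <= t /\ 0 < t /\ w t / t < eps.

Definition youngc {R : realType} (w : R -> R) (x : R) : R :=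
  sup [set x * y - w (expR y) | y in `[0%R, +oo[].

Definition mindex (r : nat) := {ffun 'I_r -> nat}.
Definition mlen {r : nat} (a : mindex r) : nat := (\sum_(i < r) a i)%N.

Definition wgt {R : realType} (w : R -> R) (l : R) {r : nat} (a : mindex r) : R :=
  expR (youngc w (l * (mlen a)%:R) / l).

Definition cabs {R : realType} (z : R[i]) : R := Normc.normc z.

Definition cseq (R : realType) (r : nat) := mindex r -> R[i].
Definition sqzero (R : realType) (r : nat) : cseq R r := fun _ => 0.
Definition sqadd {R : realType} {r : nat} (b c : cseq R r) : cseq R r :=
  fun a => b a + c a.
Definition sqscale {R : realType} {r : nat} (z : R[i]) (b : cseq R r) : cseq R r :=
  fun a => z * b a.

Definition bndl {R : realType} (w : R -> R) {r : nat} (l : R) (b : cseq R r) : Prop :=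
  exists M : R, forall a : mindex r, cabs (b a) * ((mlen a)`!)%:R <= M * wgt w l a.

Definition LamR {R : realType} (w : R -> R) (r : nat) : set (cseq R r) :=
  [set b | exists2 l : R, 0 < l & bndl w l b].
Definition LamB {R : realType} (w : R -> R) (r : nat) : set (cseq R r) :=
  [set b | forall l : R, 0 < l -> bndl w l b].

(** Frechet topology of Lambda_(w): generated by the seminorms
    p_l(b) = sup_a |b_a| |a|!/exp(phi*(l|a|)/l), l > 0 (basic neighbourhoods
    are finite intersections of seminorm balls) *)
Definition openB {R : realType} (w : R -> R) (r : nat) (A : set (cseq R r)) : Prop :=
  A `<=` LamB w r /\
  forall b, A b -> exists s : seq R, all (fun l => 0 < l) s /\
    exists2 eps : R, 0 < eps & forall c, LamB w r c ->
      (forall l, l \in s -> forall a : mindex r,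
          cabs (c a - b a) * ((mlen a)`!)%:R <= eps * wgt w l a) -> A c.

Definition absconvex {R : realType} {r : nat} (W : set (cseq R r)) : Prop :=
  forall (b c : cseq R r) (x y : R[i]), W b -> W c -> cabs x + cabs y <= 1 ->
    W (sqadd (sqscale x b) (sqscale y c)).

(** 0-neighbourhoods of the locally convex inductive limit
    Lambda_{w} = ind_{l>0} Lambda_{w,l}: sets containing an absolutely
    convex set whose trace on each Banach step Lambda_{w,l} contains a
    ball of that step *)
Definition nbhd0R {R : realType} (w : R -> R) {r : nat} (V : set (cseq R r)) : Prop :=
  exists W : set (cseq R r), W `<=` V /\ absconvex W /\
    forall l : R, 0 < l -> exists2 eps : R, 0 < eps & forall c : cseq R r,
      (forall a, cabs (c a) * ((mlen a)`!)%:R <= eps * wgt w l a) -> W c.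

Definition openR {R : realType} (w : R -> R) (r : nat) (A : set (cseq R r)) : Prop :=
  A `<=` LamR w r /\ forall b, A b -> nbhd0R w [set c | A (sqadd b c)].

Definition denseIn {T : Type} (op : set T -> Prop) (S : set T) : Prop :=
  forall U, op U -> U !=set0 -> (U `&` S) !=set0.

Definition meagerIn {T : Type} (op : set T -> Prop) (X A : set T) : Prop :=
  exists G : nat -> set T, (forall n, op (G n) /\ denseIn op (G n)) /\
    \bigcap_n G n `<=` X `\` A.

Definition compactIn {T : Type} (op : set T -> Prop) (K : set T) : Prop :=
  forall F : set (set T), (forall U, F U -> op U) -> K `<=` \bigcup_(U in F) U ->
    exists (n : nat) (V : nat -> set T), (forall i, (i < n)%N -> F (V i)) /\
      K `<=` \bigcup_(i in [set i | (i < n)%N]) V i.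

Definition haar_nullIn (R : realType) {T : Type} (op : set T -> Prop)
    (add : T -> T -> T) (X A : set T) : Prop :=
  exists B : set T, <<s X, op >> B /\ A `<=` B /\
  exists mu : set T -> \bar R,
    mu set0 = 0%E /\
    (forall E, <<s X, op >> E -> (0 <= mu E)%E) /\
    (forall F : nat -> set T, (forall n, <<s X, op >> (F n)) -> trivIset setT F ->
       (fun n => (\sum_(k < n) mu (F k))%E) @ \oo --> mu (\bigcup_n F n)) /\
    mu X = 1%E /\
    (exists K : set T, K `<=` X /\ compactIn op K /\ mu K = 1%E) /\
    (forall x, X x -> mu [set add x y | y in B] = 0%E).

Definition lineable {R : realType} {r : nat} (S : set (cseq R r)) : Prop :=
  exists V : set (cseq R r),
    V (sqzero R r) /\
    (forall b c, V b -> V c -> V (sqadd b c)) /\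
    (forall z b, V b -> V (sqscale z b)) /\
    V `<=` S `|` [set sqzero R r] /\
    exists e : nat -> cseq R r, (forall n, V (e n)) /\
      forall (n : nat) (z : nat -> R[i]),
        (forall a, \sum_(i < n) z i * e i a = 0) -> forall i, (i < n)%N -> z i = 0.

Definition ev (R : realType) (r : nat) (i : 'I_r) : 'rV[R]_r := delta_mx 0 i.

Definition pd {R : realType} {r : nat} (i : 'I_r) (g : 'rV[R]_r -> R) : 'rV[R]_r -> R :=
  fun x => 'D_(ev R r i) g x.

Definition pdseq {R : realType} {r : nat} (s : seq 'I_r) (g : 'rV[R]_r -> R) :=
  foldr (@pd R r) g s.

Definition pdm {R : realType} {r : nat} (a : mindex r) (g : 'rV[R]_r -> R) :=
  foldr (fun i h => iter (a i) (@pd R r i) h) g (enum 'I_r).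

Definition smooth_on {R : realType} {r : nat} (U : set 'rV[R]_r) (g : 'rV[R]_r -> R) : Prop :=
  forall (s : seq 'I_r) (x : 'rV[R]_r), U x ->
    {for x, continuous (pdseq s g)} /\ forall j, derivable (pdseq s g) x (ev R r j).

Definition cpd {R : realType} {r : nat} (a : mindex r) (f : 'rV[R]_r -> R[i])
    (x : 'rV[R]_r) : R[i] :=
  (pdm a (fun y => complex.Re (f y)) x +i* pdm a (fun y => complex.Im (f y)) x)%C.

Definition csmooth_on {R : realType} {r : nat} (U : set 'rV[R]_r) (f : 'rV[R]_r -> R[i]) :=
  smooth_on U (fun y => complex.Re (f y)) /\ smooth_on U (fun y => complex.Im (f y)).

Definition classR {R : realType} (w : R -> R) {r : nat} (U : set 'rV[R]_r)
    (f : 'rV[R]_r -> R[i]) : Prop :=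
  csmooth_on U f /\
  forall K : set 'rV[R]_r, compact K -> K `<=` U ->
    exists2 l : R, 0 < l & exists M : R, forall (a : mindex r) x, K x ->
      cabs (cpd a f x) <= M * wgt w l a.
Definition classB {R : realType} (w : R -> R) {r : nat} (U : set 'rV[R]_r)
    (f : 'rV[R]_r -> R[i]) : Prop :=
  csmooth_on U f /\
  forall K : set 'rV[R]_r, compact K -> K `<=` U ->
    forall l : R, 0 < l -> exists M : R, forall (a : mindex r) x, K x ->
      cabs (cpd a f x) <= M * wgt w l a.

Definition cube (R : realType) (r : nat) (k : nat) : set 'rV[R]_r :=
  [set x | forall i, `|x 0 i| < k%:R^-1].

Definition jet {R : realType} {r : nat} (f : 'rV[R]_r -> R[i]) : cseq R r :=
  fun a => cpd a f 0 / ((mlen a)`!)%:R.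

Definition jetR {R : realType} (w : R -> R) (r : nat) : set (cseq R r) :=
  [set b | exists k : nat, (0 < k)%N /\ exists f, classR w (cube R r k) f /\ b = jet f].
Definition jetB {R : realType} (w : R -> R) (r : nat) : set (cseq R r) :=
  [set b | exists k : nat, (0 < k)%N /\ exists f, classB w (cube R r k) f /\ b = jet f].

(* Main.v *)
Require Import Defs.
From mathcomp Require Import all_boot all_order all_algebra.
From mathcomp Require Import all_classical all_reals all_analysis.
From mathcomp Require Import measurable_realfun complex ring lra zify.
Import Order.TTheory GRing.Theory Num.Theory.
Import numFieldNormedType.Exports.
Local Open Scope classical_set_scope.
Local Open Scope ring_scope.
Set Implicit Arguments.
Unset Strict Implicit.

(** The proof rests on a one-sided version of Bang's proof of the
    Denjoy-Carleman theorem.  If [g] belongs to a quasianalytic class on [[0, a]]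
    and [g^(n) (0) >= 0] for all large [n], then those derivatives stay
    nonnegative on [[0, a]], so Taylor's formula bounds [g^(n) (0) / n!]
    geometrically.  Hence a jet with nonnegative coefficients growing faster than
    any geometric sequence is not the jet of a germ of the class, whatever the
    quasianalytic weight; it suffices to look at derivatives along one coordinate
    axis.  The coefficients [exp (youngc h n) / n!] have this growth as soon as
    [liminf h t / t = 0]; one takes [h = w] in the Roumieu case and
    [h t = sqrt (t * w t)] in the Beurling case.

    Bang's estimate survives when [g] is only required to match finitely many
    Taylor coefficients approximately.  The sequences that can be approximated in
    this sense, with fixed constants, form sets closed under pointwise convergence
    whose countable union is a linear subspace containing all jets: this yields
    meagerness without any compactness argument, and Lebesgue measure on a segment
    transverse to that subspace witnesses Haar-nullness.  Multiplying a
    supergeometric sequence by [p (2^-n)] for polynomials [p] gives lineability. *)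

(** * One-sided Bang estimates *)

Lemma derive_ge0_le (R : realType) (g dg : R -> R) (a b : R) :
  a <= b -> (forall x, a <= x <= b -> is_derive x 1 g (dg x)) ->
  (forall x, a <= x <= b -> 0 <= dg x) -> g a <= g b.
Proof.
move=> ab gd dg0.
have [c cab e] : exists2 c, c \in `[a, b] & g b - g a = dg c * (b - a).
  apply: MVT_segment => //.
    by move=> x; rewrite in_itv/= => /andP[ax xb]; apply: gd; rewrite !ltW.
  apply: derivable_within_continuous => x; rewrite in_itv/= => xab.
  by case: (gd _ xab).
rewrite -subr_ge0 e mulr_ge0 ?subr_ge0 ?dg0 //.
Qed.

(** A function is kept with all its derivatives as one family, so that towers can be combined
    linearly term by term. *)
Definition derivative_tower {R : realType} (a : R) (F : nat -> R -> R) : Prop :=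
  forall (n : nat) (s : R), 0 <= s <= a -> is_derive s 1 (F n) (F n.+1 s).

Definition bounded_tower {R : realType} (W : nat -> R) (a M : R)
    (F : nat -> R -> R) : Prop :=
  forall (n : nat) (s : R), 0 <= s <= a -> `|F n s| <= M * W n.

(* The negative parts at [x] of the derivatives of order at least [n1] are
   bounded by [M e^(j-N) W_j]: a one-sided version of Bang's norm. *)
Definition bang_le {R : realType} (W : nat -> R) (M : R) (n1 : nat)
    (F : nat -> R -> R) (N : nat) (x : R) : Prop :=
  forall j : nat, (n1 <= j)%N -> - (M * expR (j%:R - N%:R) * W j) <= F j x.

(* For [j < N] the function [F_j (x + s) + M e^(j-N) W_j exp (e m s)] is
   nondecreasing in [s], by downward induction on [j]. *)
Lemma bang_growth (R : realType) (W : nat -> R) (a M m : R) (n1 N : nat)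
    (F : nat -> R -> R) (x : R) :
  derivative_tower a F -> bounded_tower W a M F -> 0 <= M ->
  (forall j, 0 < W j) -> 0 <= m ->
  (forall j, (n1 <= j < N)%N -> W j.+1 <= m * W j) ->
  0 <= x -> bang_le W M n1 F N x ->
  forall (j : nat) (s : R), (n1 <= j)%N -> 0 <= s -> x + s <= a ->
    - (M * expR (j%:R - N%:R) * W j * expR (expR 1 * m * s)) <= F j (x + s).
Proof.
move=> dF bF M0 W0 m0 Wm x0 Bx.
(* For [j >= N] both exponentials are at least 1, so the uniform bound [M * W j] suffices. *)
have high (j : nat) (s : R) : (N <= j)%N -> 0 <= s -> x + s <= a ->
    - (M * expR (j%:R - N%:R) * W j * expR (expR 1 * m * s)) <= F j (x + s).
  move=> Nj s0 xsa.
  have := bF j (x + s); rewrite addr_ge0 // xsa => /(_ isT).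
  rewrite ler_norml => /andP[+ _]; apply: le_trans; rewrite lerN2.
  rewrite -!mulrA ler_wpM2l // mulrCA ler_peMr ?(ltW (W0 j)) //.
  rewrite -expRD -[leLHS]expR0 ler_expR addr_ge0 //.
    by rewrite subr_ge0 ler_nat.
  by rewrite !mulr_ge0 ?expR_ge0.
move=> j s n1j s0 xsa; have [Nj|jN] := leqP N j; first exact: high.
have [k kE] : exists k, N = (j + k)%N by exists (N - j)%N; rewrite subnKC // ltnW.
elim: k j n1j {jN} kE s s0 xsa => [|k IH] j n1j kE s s0 xsa.
  by apply: high => //; rewrite kE addn0.
set C := fun i : nat => M * expR (i%:R - N%:R) * W i.
have {}IH (u : R) : 0 <= u -> x + u <= a ->
    - (C j.+1 * expR (expR 1 * m * u)) <= F j.+1 (x + u).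
  by apply: IH; [exact: leqW|rewrite kE addnS addSn].
(* Raising [j] by one costs [e] in [expR (j - N)] and [m] in [W]. Differentiating
   [expR (expR 1 * m * s)] produces the same factor, so the derivative of [g] is nonnegative. *)
have CS : C j.+1 <= C j * (expR 1 * m).
  rewrite /C -natr1 -addrA [1 - _]addrC addrA expRD -!mulrA ler_wpM2l //.
  rewrite ler_wpM2l ?expR_ge0 // mulrCA ler_wpM2l ?expR_ge0 // mulrC.
  by rewrite mulrC [X in _ <= X]mulrC Wm // n1j kE -addn1 leq_add2l.
pose g u := F j (x + u) + C j * expR (expR 1 * m * u).
have gd (u : R) : 0 <= u <= s ->
    is_derive u 1 g (F j.+1 (x + u) + C j * (expR 1 * m) * expR (expR 1 * m * u)).
  move=> /andP[u0 us].
  have d1 : is_derive (x + u) 1 (F j) (F j.+1 (x + u)).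
    by apply: dF; rewrite addr_ge0 //= (le_trans _ xsa) // lerD2l.
  have d2 : is_derive u 1 (fun t => x + t) (0 + 1) by apply: is_deriveD.
  have d3 := is_derive1_comp d1 d2.
  have d4 : is_derive u 1 ( *%R (expR 1 * m)) ((expR 1 * m) *: 1).
    exact: is_deriveZ.
  have d5 := is_derive1_comp (is_derive_expR (expR 1 * m * u)) d4.
  have d6 := is_deriveZ (C j) d5.
  have H := is_deriveD d3 d6.
  have gE : g = (F j \o (fun t => x + t)) + (C j *: (expR \o ( *%R (expR 1 * m)))) by [].
  rewrite gE; apply: (is_derive_eq H).
  by rewrite add0r mulr1 /GRing.scale /=; ring.
rewrite -/(C j) -subr_ge0 opprK -/(g s).
have g0 : 0 <= g 0.
  by rewrite /g addr0 mulr0 expR0 mulr1 -[C j]opprK subr_ge0; exact: Bx.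
apply: (le_trans g0); apply: (derive_ge0_le s0 gd) => u /andP[u0 us].
have xua : x + u <= a by rewrite (le_trans _ xsa) // lerD2l.
rewrite -[X in _ + X]opprK subr_ge0 (le_trans _ (IH u u0 xua)) //.
by rewrite lerN2 ler_wpM2r ?expR_ge0.
Qed.

(** On a step of length at most [1 / (e m)] the factor [expR (e m s)] is at most [e], which is the
    worth of one level of [bang_le]. *)
Lemma bang_step (R : realType) (W : nat -> R) (a M m : R) (n1 N : nat)
    (F : nat -> R -> R) (x s : R) :
  derivative_tower a F -> bounded_tower W a M F -> 0 <= M ->
  (forall j, 0 < W j) -> 0 < m ->
  (forall j, (n1 <= j < N.+1)%N -> W j.+1 <= m * W j) ->
  0 <= x -> 0 <= s -> x + s <= a -> s <= (expR 1 * m)^-1 ->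
  bang_le W M n1 F N.+1 x -> bang_le W M n1 F N (x + s).
Proof.
move=> dF bF M0 W0 m0 Wm x0 s0 xsa sm Bx j n1j.
have := bang_growth dF bF M0 W0 (ltW m0) Wm x0 Bx n1j s0 xsa.
apply: le_trans; rewrite lerN2 -!mulrA ler_wpM2l //.
rewrite mulrCA [X in _ <= X]mulrC ler_wpM2l ?(ltW (W0 j)) //.
rewrite -expRD ler_expR.
have : expR 1 * m * s <= 1.
  by rewrite -ler_pdivlMl ?mulr1 // mulr_gt0 ?expR_gt0.
rewrite -natr1 mulrA; lra.
Qed.

(* Descending from level [n0 + d] to level [n0] takes a distance of at least
   [\sum 1 / (e mu_i)]. *)
Lemma bang_chain (R : realType) (W mu : nat -> R) (a M : R) (n1 n0 d : nat)
    (F : nat -> R -> R) :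
  derivative_tower a F -> bounded_tower W a M F -> 0 <= M ->
  (forall j, 0 < W j) -> (forall j, 0 < mu j) ->
  (forall i j, (i <= j)%N -> W i.+1 <= mu j * W i) ->
  forall x s : R, 0 <= x -> 0 <= s -> x + s <= a ->
  s <= \sum_(i < d) (expR 1 * mu (n0 + i)%N)^-1 ->
  bang_le W M n1 F (n0 + d) x -> bang_le W M n1 F n0 (x + s).
Proof.
move=> dF bF M0 W0 mu0 Wmu.
elim: d => [|d IH] x s x0 s0 xsa; first rewrite big_ord0 addn0 => sle0.
  suff -> : s = 0 by rewrite addr0.
  by apply/eqP; rewrite eq_le s0 sle0.
rewrite big_ord_recr /= => sle Bx.
set q := (expR 1 * mu (n0 + d)%N)^-1 in sle *.
have q0 : 0 < q by rewrite invr_gt0 mulr_gt0 ?expR_gt0.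
(* The first step, of length [min s q], goes from level [n0 + d + 1] to level [n0 + d]; induction
   covers the remaining distance. *)
have s1 : Num.min s q <= s by rewrite ge_min lexx.
have s2 : Num.min s q <= q by rewrite ge_min lexx orbT.
have s3 : 0 <= Num.min s q by rewrite le_min s0 ltW.
rewrite -[s](subrK (Num.min s q)) [_ - _ + _]addrC addrA; apply: IH.
- exact: addr_ge0.
- by rewrite subr_ge0.
- by rewrite -addrA [_ + (s - _)]addrC subrK.
- rewrite /Num.min; case: ifPn => _; last by rewrite lerBlDr.
  rewrite subrr sumr_ge0 // => i _.
  by rewrite invr_ge0 mulr_ge0 ?expR_ge0 // ltW.
- apply: (@bang_step _ _ a _ (mu (n0 + d)%N)) => //.
  + by move=> j /andP[_ jd]; apply: Wmu.
  + by rewrite (le_trans _ xsa) // lerD2l.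
  + by rewrite -addnS.
Qed.

(** The tower may change with [N] and [eps] while [W], [a] and [M] stay fixed: failure is then
    witnessed by finitely many coefficients, which makes the condition closed. [u] holds Taylor
    coefficients, hence the factorial. *)
Definition almost_jet {R : realType} (W : nat -> R) (a M : R) (u : nat -> R) : Prop :=
  forall (N : nat) (eps : R), 0 < eps -> exists F : nat -> R -> R,
    [/\ derivative_tower a F, bounded_tower W a M F &
        forall n, (n <= N)%N -> `|F n 0 - n`!%:R * u n| <= eps].

Lemma ex_pos_lower_bound (R : realType) (c : nat -> R) (N : nat) :
  (forall j, 0 < c j) -> exists2 eps : R, 0 < eps & forall j, (j <= N)%N -> eps <= c j.
Proof.
move=> c0; elim: N => [|N [e e0 H]].
  by exists (c 0) => // j; rewrite leqn0 => /eqP ->.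
exists (Num.min e (c N.+1)) => [|j]; first by rewrite lt_min e0 c0.
rewrite leq_eqVlt ltnS => /orP[/eqP ->|/H ejc]; rewrite ge_min ?lexx ?orbT //.
by rewrite ejc.
Qed.

(** Since [u] is nonnegative from [n1] on, matching finitely many coefficients well enough gives
    [bang_le] at 0 for a high level. Divergence of the series lets the descent cross all of [[0, a]]
    and still end at a level [n0] where the error is below [delta]. *)
Lemma almost_jet_almost_nonneg (R : realType) (W mu : nat -> R) (a M : R)
    (u : nat -> R) (n1 m : nat) (delta : R) :
  0 < a -> 0 < M -> (forall j, 0 < W j) -> (forall j, 0 < mu j) ->
  (forall i j, (i <= j)%N -> W i.+1 <= mu j * W i) ->
  (forall A : R, exists n, A <= \sum_(i < n) (mu i)^-1) ->
  (forall n, (n1 <= n)%N -> 0 <= u n) -> almost_jet W a M u -> 0 < delta ->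
  exists F : nat -> R -> R,
    [/\ derivative_tower a F, bounded_tower W a M F,
        `|F m 0 - m`!%:R * u m| <= delta &
        forall (n : nat) (s : R), (n1 <= n <= m.+1)%N -> 0 <= s <= a -> - delta <= F n s].
Proof.
move=> a0 M0 W0 mu0 Wmu div u0 uJ d0.
(* [S] dominates [M * expR n * W n] for all [n <= m + 1], and [expR n0 >= 1 + n0 > S / delta]. *)
pose S := \sum_(n < m.+2) M * expR n%:R * W n.
have S0 (n : 'I_m.+2) : 0 <= M * expR n%:R * W n by rewrite !mulr_ge0 ?expR_ge0 ?ltW.
pose n0 := Num.trunc (S / delta).
have n0S : S * expR (- n0%:R) <= delta.
  rewrite expRN ler_pdivrMr ?expR_gt0 // mulrC -ler_pdivrMr //.
  apply: le_trans (ltW (truncnS_gt _)) _.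
  by rewrite -natr1 addrC; exact: expR_ge1Dx.
have small n : (n <= m.+1)%N -> M * expR (n%:R - n0%:R) * W n <= delta.
  move=> nm; apply: le_trans n0S; rewrite expRD mulrA mulrAC ler_wpM2r ?expR_ge0 //.
  have nm2 : (n < m.+2)%N by [].
  by rewrite /S (bigD1 (Ordinal nm2)) //= lerDl sumr_ge0.
have [d dE] : exists d, a <= \sum_(i < d) (expR 1 * mu (n0 + i)%N)^-1.
  have [d dE] := div (expR 1 * a + \sum_(i < n0) (mu i)^-1).
  exists d; rewrite (eq_bigr (fun i : 'I_d => (expR 1)^-1 * (mu (n0 + i)%N)^-1)); last first.
    by move=> i _; rewrite invfM.
  rewrite -mulr_sumr mulrC ler_pdivlMr ?expR_gt0 // mulrC.
  rewrite -(lerD2r (\sum_(i < n0) (mu i)^-1)) (le_trans dE) // addrC.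
  have <- : \sum_(i < n0 + d) (mu i)^-1 =
      \sum_(i < n0) (mu i)^-1 + \sum_(i < d) (mu (n0 + i)%N)^-1.
    by rewrite big_split_ord.
  rewrite addnC big_split_ord /=.
  by rewrite lerDl sumr_ge0 // => i _; rewrite invr_ge0 ltW.
pose N := (n0 + d)%N.
(* An error of at most [e] in the coefficients stays within the slack of [bang_le] at level [N]; the
   order [N + m] used next also covers the index [m]. *)
have [e e0 eN] := @ex_pos_lower_bound R (fun j => M * expR (j%:R - N%:R) * W j) N
  (fun j => mulr_gt0 (mulr_gt0 M0 (expR_gt0 _)) (W0 j)).
have [|F [dF bF FJ]] := uJ (N + m)%N (Num.min e delta); first by rewrite lt_min e0 d0.
exists F; split => //.
  by apply: (le_trans (FJ m (leq_addl _ _))); rewrite ge_min lexx orbT.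
move=> n s /andP[n1n nm] /andP[s0 sa].
have BN : bang_le W M n1 F N 0.
  move=> j n1j; have [Nj|jN] := leqP N j.
    have := bF j 0; rewrite lexx ltW // ler_norml => /(_ isT)/andP[+ _].
    apply: le_trans; rewrite lerN2 -!mulrA ler_wpM2l ?(ltW M0) //.
    rewrite ler_peMl ?(ltW (W0 j)) // -[leLHS]expR0 ler_expR.
    by rewrite subr_ge0 ler_nat.
  have := FJ j (leq_trans (ltnW jN) (leq_addr _ _)).
  rewrite ler_norml => /andP[+ _]; rewrite lerBrDl; apply: le_trans.
  rewrite (@le_trans _ _ (- Num.min e delta)) ?lerDr ?mulr_ge0 ?u0 //.
  by rewrite lerN2 ge_min eN // ltnW.
have := @bang_chain R W mu a M n1 n0 d F dF bF (ltW M0) W0 mu0 Wmu 0 s.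
rewrite add0r => /(_ (lexx _) s0 sa (le_trans sa dE) BN n n1n).
by apply: le_trans; rewrite lerN2 small.
Qed.

Lemma is_derive_monomial (R : realType) (k : nat) (x : R) :
  is_derive x 1 (fun s : R => s ^+ k.+1 / k.+1`!%:R) (x ^+ k / k`!%:R).
Proof.
have := @is_deriveX _ _ (@id R) k.+1 x 1 1 (is_derive_id _ _).
move=> /(is_deriveZ (k.+1`!%:R^-1 : R)) H.
have -> : (fun s : R => s ^+ k.+1 / k.+1`!%:R) = (k.+1`!%:R^-1) \*: (@id R ^+ k.+1).
  by apply/funext => s; rewrite /= mulrC /GRing.scale /= fctE.
apply: (is_derive_eq H).
rewrite /GRing.scale /= mulr1 factS natrM; field.
by rewrite nat1r !pnatr_eq0 -lt0n fact_gt0.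
Qed.

(** Integrating almost nonnegative derivatives from order [m] down to [n1] shows that [F n1 a],
    which is at most [M * W n1], is up to a small error at least the single Taylor term
    [m! u_m a^(m-n1) / (m-n1)!]. *)
Lemma almost_jet_geometric (R : realType) (W mu : nat -> R) (a M : R)
    (u : nat -> R) (n1 : nat) :
  0 < a -> a <= 1 -> 0 < M -> (forall j, 0 < W j) -> (forall j, 0 < mu j) ->
  (forall i j, (i <= j)%N -> W i.+1 <= mu j * W i) ->
  (forall A : R, exists n, A <= \sum_(i < n) (mu i)^-1) ->
  (forall n, (n1 <= n)%N -> 0 <= u n) -> almost_jet W a M u ->
  forall m, (n1 <= m)%N -> u m <= M * W n1 * a^-1 ^+ m.
Proof.
move=> a0 a1 M0 W0 mu0 Wmu div u0 uJ m n1m.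
pose A := m`!%:R * u m.
have A0 : 0 <= A by rewrite mulr_ge0 ?u0.
(* [(m - n1)! <= m!] and [a <= 1] bound the Taylor term below by [u m * a ^+ m]. *)
suff H : A * (a ^+ (m - n1) / (m - n1)`!%:R) <= M * W n1.
  rewrite exprVn ler_pdivlMr ?exprn_gt0 //; apply: le_trans H.
  rewrite /A -mulrA mulrCA ler_wpM2l ?u0 // mulrCA.
  apply: le_trans (ler_wiXn2l (ltW a0) a1 (leq_subr n1 m)) _.
  rewrite ler_peMr ?exprn_ge0 ?(ltW a0) // ler_pdivlMr ?ltr0n ?fact_gt0 // mul1r.
  by rewrite ler_nat leq_fact // leq_subr.
apply/ler_addgt0Pr => e e0.
(* The error starts at two [delta], one from [F m 0] and one from [F m.+1], and each integration
   adds at most one more because [a <= 1]. *)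
pose delta := e / (m + 2)%:R.
have d0 : 0 < delta by rewrite divr_gt0 // ltr0n addn2.
have [F [dF bF F0 Fpos]] :=
  almost_jet_almost_nonneg m a0 M0 W0 mu0 Wmu div u0 uJ d0.
have key (k : nat) : (k <= m - n1)%N -> forall s : R, 0 <= s <= a ->
    A * (s ^+ k / k`!%:R) - delta * (k + 2)%:R <= F (m - k)%N s.
  elim: k => [|k IH] km s /andP[s0 sa].
    rewrite subn0 expr0 fact0 divr1 mulr1.
    pose g t := F m t + delta * t.
    have : g 0 <= g s.
      apply: (@derive_ge0_le _ g (fun t => F m.+1 t + delta)) => // t /andP[t0 ts].
        have := is_deriveD (dF m t _) (is_deriveZ delta (is_derive_id t 1)).
        rewrite t0 (le_trans ts sa) => /(_ isT) H.
        by apply: (is_derive_eq H); rewrite /GRing.scale /= mulr1.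
      rewrite -lerBlDr sub0r Fpos ?t0 ?(le_trans ts sa) //.
      by rewrite leqnn andbT leqW.
    rewrite /g mulr0 addr0; move: F0; rewrite ler_norml -/A => /andP[+ _].
    have : delta * s <= delta by rewrite ler_piMr ?(ltW d0) ?(le_trans sa a1).
    rewrite add0n; lra.
  have km' : (k <= m - n1)%N by exact: ltnW.
  have mk : ((m - k.+1).+1 = m - k)%N by lia.
  pose g t := F (m - k.+1)%N t - A * (t ^+ k.+1 / k.+1`!%:R) + delta * (k + 2)%:R * t.
  have : g 0 <= g s.
    apply: (@derive_ge0_le _ g (fun t => F (m - k)%N t - A * (t ^+ k / k`!%:R) +
        delta * (k + 2)%:R)) => // t /andP[t0 ts].
      have ta : 0 <= t <= a by rewrite t0 (le_trans ts sa).
      have H1 := dF (m - k.+1)%N t ta.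
      have H2 := is_deriveZ (- A) (is_derive_monomial k t).
      have H3 := is_deriveZ (delta * (k + 2)%:R) (is_derive_id t 1).
      have H := is_deriveD (is_deriveD H1 H2) H3.
      have -> : g = F (m - k.+1)%N + (- A) \*: (fun s : R => s ^+ k.+1 / k.+1`!%:R)
          + (delta * (k + 2)%:R) \*: id.
        by apply/funext => x; rewrite /g /= !fctE -mulNr.
      by apply: (is_derive_eq H); rewrite mk /GRing.scale /= mulr1 mulNr.
    have := IH km' t; rewrite t0 (le_trans ts sa) => /(_ isT); lra.
  rewrite /g mulr0 addr0 expr0n /= mul0r mulr0 subr0 => gs.
  have F0' : - delta <= F (m - k.+1)%N 0.
    apply: Fpos; last by rewrite lexx ltW.
    by apply/andP; split; lia.
  have : delta * (k + 2)%:R * s <= delta * (k + 2)%:R.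
    by rewrite ler_piMr ?(le_trans sa a1) // mulr_ge0 // ltW.
  rewrite addSn -natr1 mulrDr mulr1; lra.
have := key (m - n1)%N (leqnn _) a; rewrite lexx ltW // => /(_ isT).
rewrite subKn //; have := bF n1 a; rewrite lexx ltW // => /(_ isT).
rewrite ler_norml => /andP[_ Fa].
have : delta * (m - n1 + 2)%:R <= e.
  rewrite /delta mulrAC ler_pdivrMr ?ltr0n ?addn2 // ler_pM2l // ler_nat; lia.
lra.
Qed.

(** * Weight functions and their Young conjugates *)

(** A sequence of the weight matrix associated with [w]; [wgt w l a] is its term of index
    [mlen a]. *)
Definition wseq {R : realType} (w : R -> R) (l : R) (n : nat) : R :=
  expR (youngc w (l * n%:R) / l).

Definition wquot {R : realType} (w : R -> R) (l : R) (n : nat) : R :=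
  wseq w l n.+1 / wseq w l n.

Lemma wseq_gt0 (R : realType) (w : R -> R) (l : R) (n : nat) : 0 < wseq w l n.
Proof. exact: expR_gt0. Qed.

Lemma wquot_gt0 (R : realType) (w : R -> R) (l : R) (n : nat) : 0 < wquot w l n.
Proof. by rewrite divr_gt0 ?wseq_gt0. Qed.

Lemma youngc_le (R : realType) (h : R -> R) (x c : R) :
  (forall y, 0 <= y -> x * y - h (expR y) <= c) -> youngc h x <= c.
Proof.
move=> H; apply: ge_sup.
  by exists (x * 0 - h (expR 0)), 0 => //=; rewrite in_itv /= lexx.
by move=> _ [y /= + <-]; rewrite in_itv /= andbT => /H.
Qed.

(** The bound [c] makes the supremum genuine: [sup] of an unbounded set is a default value. *)
Lemma youngc_ub (R : realType) (h : R -> R) (x c y : R) :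
  (forall z, 0 <= z -> x * z - h (expR z) <= c) -> 0 <= y ->
  x * y - h (expR y) <= youngc h x.
Proof.
move=> H y0; apply: ub_le_sup; last by exists y => //=; rewrite in_itv /= y0.
by exists c => _ [z /= + <-]; rewrite in_itv /= andbT => /H.
Qed.

Lemma weight_ge0 (R : realType) (w : R -> R) (t : R) : in_W w -> 0 <= t -> 0 <= w t.
Proof. by move=> [[_ [_ [w0 _]]] _]; exact: w0. Qed.

Lemma weight_le (R : realType) (w : R -> R) (s t : R) :
  in_W w -> 0 <= s -> s <= t -> w s <= w t.
Proof. by move=> [[_ [wm _]] _]; exact: wm. Qed.

Lemma weight1 (R : realType) (w : R -> R) : in_W w -> w 1 = 0.
Proof. by move=> [[_ [_ [_ [w1 _]]]] _]; exact: w1. Qed.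

(** Because [log t = o(w t)], [w (expR y)] is at least [(|x| + 1) y] once [expR y >= T]; the other
    [y] are at most [|T|]. *)
Lemma young_has_ub (R : realType) (w : R -> R) (x : R) : in_W w ->
  exists c, forall y, 0 <= y -> x * y - w (expR y) <= c.
Proof.
move=> wW; have [_ [_ [wlog _]]] := wW.
have [|T HT] := wlog (`|x| + 1)^-1; first by rewrite invr_gt0 ltr_wpDl.
exists (`|x| * `|T|) => y y0.
have w0 : 0 <= w (expR y) by rewrite weight_ge0 ?expR_ge0.
have xy : x * y <= `|x| * y by rewrite ler_wpM2r ?ler_norm.
have x0 : 0 <= `|x| by [].
have [Ty|yT] := leP T (expR y).
  have := HT _ Ty; rewrite expRK ger0_norm // ler_pdivlMl ?ltr_wpDl // => H.
  have : 0 <= `|x| * `|T| by rewrite mulr_ge0.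
  nra.
have yT' : y <= `|T|.
  rewrite (le_trans _ (ler_norm T)) // (le_trans _ (ltW yT)) //.
  by have := expR_ge1Dx y; lra.
have : `|x| * y <= `|x| * `|T| by rewrite ler_wpM2l.
lra.
Qed.

Lemma young_ge (R : realType) (w : R -> R) (x y : R) : in_W w -> 0 <= y ->
  x * y - w (expR y) <= youngc w x.
Proof. by move=> /(@young_has_ub _ _ x)[c H]; exact: youngc_ub H. Qed.

Lemma young0 (R : realType) (w : R -> R) : in_W w -> youngc w 0 = 0.
Proof.
move=> wW; apply/eqP; rewrite eq_le; apply/andP; split.
  apply: youngc_le => y y0; rewrite mul0r sub0r oppr_le0.
  by rewrite weight_ge0 ?expR_ge0.
by have := young_ge 0 wW (lexx 0); rewrite mul0r expR0 weight1 // subrr.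
Qed.

Lemma young_homo (R : realType) (w : R -> R) (x x' : R) : in_W w -> x <= x' ->
  youngc w x <= youngc w x'.
Proof.
move=> wW xx'; apply: youngc_le => y y0.
by apply: le_trans (young_ge x' wW y0); rewrite lerD2r ler_wpM2r.
Qed.

Lemma young_midpoint (R : realType) (w : R -> R) (x d : R) : in_W w ->
  youngc w x *+ 2 <= youngc w (x - d) + youngc w (x + d).
Proof.
move=> wW; suff : youngc w x <= (youngc w (x - d) + youngc w (x + d)) / 2.
  by rewrite ler_pdivlMr // mulr_natr.
apply: youngc_le => y y0.
have := young_ge (x - d) wW y0; have := young_ge (x + d) wW y0; lra.
Qed.

Lemma wseq0 (R : realType) (w : R -> R) (l : R) : in_W w -> wseq w l 0 = 1.
Proof. by move=> wW; rewrite /wseq mulr0 young0 // mul0r expR0. Qed.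

(** [youngc w (l n) / l] is the supremum of [n y - w (expR y) / l], which grows with [l] because
    [w >= 0]. *)
Lemma wseq_homo (R : realType) (w : R -> R) (l l' : R) (n : nat) : in_W w ->
  0 < l -> l <= l' -> wseq w l n <= wseq w l' n.
Proof.
move=> wW l0 ll'; have l'0 := lt_le_trans l0 ll'.
rewrite ler_expR ler_pdivrMr //; apply: youngc_le => y y0.
have r0 : 0 <= l / l' by rewrite divr_ge0 // ltW.
have r1 : l / l' <= 1 by rewrite ler_pdivrMr // mul1r.
have := ler_wpM2r r0 (young_ge (l' * n%:R) wW y0).
have -> : youngc w (l' * n%:R) / l' * l = youngc w (l' * n%:R) * (l / l') by ring.
apply: le_trans; rewrite mulrBl.
have -> : l' * n%:R * y * (l / l') = l * n%:R * y by field; rewrite gt_eqF.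
by rewrite lerD2l lerN2 ler_piMr // weight_ge0 ?expR_ge0.
Qed.

(** Log-convexity of [wseq w l], inherited from the Young conjugate as a supremum of affine
    functions. *)
Lemma wquot_homo (R : realType) (w : R -> R) (l : R) : in_W w -> 0 < l ->
  {homo wquot w l : i j / (i <= j)%N >-> i <= j}.
Proof.
move=> wW l0; apply: homo_leq => [//|y x z|n]; first exact: le_trans.
rewrite /wquot /wseq -!expRB ler_expR -!mulrBl ler_wpM2r ?invr_ge0 ?(ltW l0) //.
have := young_midpoint (l * n.+1%:R) l wW.
have -> : l * n.+1%:R - l = l * n%:R by rewrite -natr1; ring.
have -> : l * n.+1%:R + l = l * n.+2%:R by rewrite -!natr1; ring.
lra.
Qed.

Lemma wseq_le_wquot (R : realType) (w : R -> R) (l : R) (i j : nat) :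
  in_W w -> 0 < l -> (i <= j)%N -> wseq w l i.+1 <= wquot w l j * wseq w l i.
Proof.
move=> wW l0 ij; rewrite -ler_pdivrMr ?wseq_gt0 //; exact: wquot_homo.
Qed.

Lemma ln_wseq (R : realType) (w : R -> R) (l : R) (j : nat) : in_W w ->
  youngc w (l * j%:R) / l = \sum_(i < j) ln (wquot w l i).
Proof.
move=> wW; rewrite -[LHS]expRK -/(wseq w l j).
elim: j => [|j IH]; first by rewrite big_ord0 wseq0 // ln1.
rewrite big_ord_recr /= -IH -lnM ?posrE ?wseq_gt0 ?wquot_gt0 //.
by rewrite /wquot mulrC divfK // gt_eqF ?wseq_gt0.
Qed.

(** The slope is the supremum of the chord slopes to the left of [y]; convexity puts it below every
    chord slope to the right. At [y = 0] the slope 0 works, since [w 1 = 0] is the minimum. *)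
Lemma weight_subgradient (R : realType) (w : R -> R) (y : R) : in_W w -> 0 <= y ->
  exists2 x, 0 <= x & forall z, 0 <= z -> w (expR y) + x * (z - y) <= w (expR z).
Proof.
move=> wW; rewrite le_eqVlt => /orP[/eqP <-|y0].
  exists 0 => // z z0; rewrite mul0r addr0 expR0 weight1 //.
  by rewrite weight_ge0 ?expR_ge0.
have [_ [_ [_ cvx]]] := wW.
pose phi z := w (expR z).
have slopes a b : 0 <= a < y -> y < b ->
    (phi y - phi a) / (y - a) <= (phi b - phi y) / (b - y).
  move=> /andP[a0 ay] yb; have ba : 0 < b - a by lra.
  have L0 : 0 <= (b - y) / (b - a) by apply: divr_ge0; lra.
  have L1 : (b - y) / (b - a) <= 1 by rewrite ler_pdivrMr // mul1r; lra.
  have := cvx a b _ L0 L1.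
  have -> : (b - y) / (b - a) * a + (1 - (b - y) / (b - a)) * b = y.
    by field; rewrite gt_eqF.
  have -> : 1 - (b - y) / (b - a) = (y - a) / (b - a) by field; rewrite gt_eqF.
  rewrite [_ * w _]mulrAC [X in _ + X]mulrAC -mulrDl ler_pdivlMr // => H.
  rewrite ler_pdivrMr ?subr_gt0 // mulrAC ler_pdivlMr ?subr_gt0 //.
  rewrite /phi; nra.
pose E := [set (phi y - phi a) / (y - a) | a in [set a | 0 <= a < y]].
have E0 : E !=set0 by exists ((phi y - phi 0) / (y - 0)), 0 => //=; rewrite lexx.
have Eub b : y < b -> ubound E ((phi b - phi y) / (b - y)).
  by move=> yb _ [a /= ay <-]; exact: slopes.
have Ele b : y < b -> sup E <= (phi b - phi y) / (b - y).
  by move=> yb; apply: ge_sup => //; exact: Eub.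
have Ege a : 0 <= a < y -> (phi y - phi a) / (y - a) <= sup E.
  move=> ay; apply: ub_le_sup; last by exists a.
  by exists ((phi (y + 1) - phi y) / (y + 1 - y)); apply: Eub; rewrite ltrDl.
exists (sup E).
  apply: (le_trans _ (Ege 0 _)); last by rewrite lexx.
  apply: divr_ge0; rewrite subr_ge0 ?(ltW y0) //.
  by apply: (weight_le wW (expR_ge0 _)); rewrite ler_expR ltW.
move=> z z0; rewrite -/(phi y) -/(phi z).
case: (ltgtP z y) => [zy|yz|->]; last by rewrite subrr mulr0 addr0.
  have := Ege z; rewrite z0 zy => /(_ isT); rewrite ler_pdivrMr ?subr_gt0 //; lra.
by have := Ele z yz; rewrite ler_pdivlMr ?subr_gt0 //; lra.
Qed.

(* Biconjugation: [w t / l] is the supremum over real [x >= 0] of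
   [x ln t - youngc w (l x) / l]; rounding [x] down costs at most [ln t]. *)
Lemma weight_le_sum_ln (R : realType) (w : R -> R) (l t : R) : in_W w -> 0 < l ->
  1 <= t -> exists j, w t <= l * (ln t + \sum_(i < j) ln (t / wquot w l i)).
Proof.
move=> wW l0 t1; have t0 : 0 < t by exact: lt_le_trans t1.
have y0 : 0 <= ln t by rewrite ln_ge0.
have [x x0 Hx] := weight_subgradient wW y0.
exists (Num.trunc (x / l)); set j := Num.trunc _.
have /andP[jx xj] : j%:R <= x / l < j.+1%:R.
  by apply: truncn_itv; rewrite divr_ge0 // ltW.
(* By the subgradient inequality, [ln t] is a maximizer in the supremum defining [youngc w x]. *)
have yx : youngc w x <= x * ln t - w t.
  apply: youngc_le => z /Hx; rewrite lnK ?posrE //; lra.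
have yj : youngc w (l * j%:R) <= youngc w x.
  by apply: young_homo => //; rewrite mulrC -ler_pdivlMr.
have -> : \sum_(i < j) ln (t / wquot w l i) = j%:R * ln t - youngc w (l * j%:R) / l.
  rewrite ln_wseq // (eq_bigr (fun i : 'I_j => ln t - ln (wquot w l i))).
    by rewrite sumrB sumr_const card_ord mulr_natl.
  by move=> i _; rewrite ln_div ?posrE ?wquot_gt0.
rewrite mulrDr mulrBr [l * (_ / l)]mulrC divfK ?gt_eqF //.
have : x * ln t <= l * j.+1%:R * ln t.
  by rewrite ler_wpM2r // mulrC -ler_pdivrMr // ltW.
rewrite -natr1; lra.
Qed.

(** * Divergence of the quotients' inverses *)

(* [t^2 * majorant c d t] dominates [c * ln (d^2 t)], and [majorant c d] has the
   antiderivative [- 16 c d^2 / (1 + d sqrt t)]. *)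
Definition majorant {R : realType} (c d t : R) : R :=
  8 * c * d ^+ 3 / (Num.sqrt t * (1 + d * Num.sqrt t) ^+ 2).

Lemma majorant_ge0 (R : realType) (c d t : R) :
  0 <= c -> 0 <= d -> 0 <= majorant c d t.
Proof.
move=> c0 d0; by rewrite divr_ge0 // !mulr_ge0 ?exprn_ge0 ?sqrtr_ge0 // addr_ge0 // mulr_ge0 ?sqrtr_ge0.
Qed.

(** With [q = d sqrt t] the claim is [2 ln q <= 8 q^3 / (1 + q)^2]. For [q >= 1] it follows from
    [ln q <= q] and [1 + q <= 2 q]; for [q < 1] the left side is nonpositive. *)
Lemma ln_le_majorant (R : realType) (c d t : R) : 0 <= c -> 0 < d -> 1 <= t ->
  c * ln (d ^+ 2 * t) <= majorant c d t * t ^+ 2.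
Proof.
move=> c0 d0 t1; have t0 : 0 < t by exact: lt_le_trans t1.
rewrite /majorant; set z := Num.sqrt t.
have z0 : 0 < z by rewrite sqrtr_gt0.
have <- : z ^+ 2 = t by rewrite sqr_sqrtr // ltW.
rewrite -exprMn; set q := d * z.
have q0 : 0 < q by rewrite mulr_gt0.
have -> : 8 * c * d ^+ 3 / (z * (1 + q) ^+ 2) * (z ^+ 2) ^+ 2 =
    c * (8 * q ^+ 3 / (1 + q) ^+ 2).
  by rewrite /q; field; rewrite !gt_eqF // ltr_wpDl // mulr_gt0.
rewrite ler_wpM2l // lnXn // -mulr_natl.
have [q1|q1] := leP 1 q; last first.
  have l0 : ln q <= 0 by rewrite ln_le0 // ltW.
  apply: (@le_trans _ _ 0); first lra.
  by rewrite divr_ge0 ?mulr_ge0 ?exprn_ge0 // ?addr_ge0 // ltW.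
have lnq : ln q <= q - 1.
  have := @le_ln1Dx R (q - 1); rewrite [1 + _]addrC subrK; apply; lra.
rewrite ler_pdivlMr ?exprn_gt0 ?addr_gt0 //.
apply: (@le_trans _ _ (2 * q * (1 + q) ^+ 2)); first by rewrite ler_wpM2r ?exprn_ge0; lra.
have : (1 + q) ^+ 2 <= 4 * q ^+ 2 by nra.
move=> H; apply: le_trans (ler_wpM2l _ H) _; nra.
Qed.

Lemma continuous_majorant (R : realType) (c d t : R) : 0 < d -> 0 < t ->
  {for t, continuous (majorant c d)}.
Proof.
move=> d0 t0.
have z0 : 0 < Num.sqrt t by rewrite sqrtr_gt0.
have cs : {for t, continuous (@Num.sqrt R)} by exact: sqrt_continuous.
apply: cvgM; first exact: cvg_cst.
apply: cvgV; first by rewrite gt_eqF // mulr_gt0 // exprn_gt0 // addr_gt0 // mulr_gt0.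
apply: cvgM => //.
have c1 : 1 + d * Num.sqrt x @[x --> t] --> 1 + d * Num.sqrt t.
  by apply: cvgD; [exact: cvg_cst|apply: cvgM => //; exact: cvg_cst].
by rewrite expr2; under eq_fun do rewrite expr2; exact: cvgM.
Qed.

Lemma integral_majorant (R : realType) (c d : R) : 0 <= c -> 0 < d ->
  (\int[@lebesgue_measure R]_(t in `[1%R, +oo[) (majorant c d t)%:E =
   (16 * c * d ^+ 2 / (1 + d))%:E)%E.
Proof.
move=> c0 d0.
pose F (t : R) : R := - (16 * c * d ^+ 2) * (1 + d * Num.sqrt t)^-1.
have den0 t : 0 < 1 + d * Num.sqrt t by rewrite ltr_pwDl // mulr_ge0 ?sqrtr_ge0 // ltW.
have dF (t : R) : 0 < t -> is_derive t 1 F (majorant c d t).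
  move=> t0; have z0 : 0 < Num.sqrt t by rewrite sqrtr_gt0.
  have H1 := is_deriveD (is_derive_cst (1 : R) t 1) (is_deriveZ d (is_derive1_sqrt t0)).
  have H2 := @is_deriveV R (cst 1 + d \*: Num.sqrt) t _ 1 (lt0r_neq0 (den0 t)) H1.
  have H3 := is_deriveZ (- (16 * c * d ^+ 2)) H2.
  apply: (is_derive_eq H3); rewrite /majorant /GRing.scale /= add0r.
  rewrite (_ : (cst 1 + d \*: Num.sqrt) t = 1 + d * Num.sqrt t) //.
  by field; rewrite !gt_eqF // den0.
rewrite (@ge0_continuous_FTC2y R (majorant c d) F 1 0).
- by rewrite -EFinB /F sqrtr1 mulr1 sub0r mulNr opprK.
- by move=> t t1; apply: majorant_ge0 => //; exact: ltW.
- apply: continuous_in_subspaceT => t; rewrite inE/= in_itv/= andbT => t1.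
  by apply: continuous_majorant => //; exact: lt_le_trans t1.
- apply/cvgrPdist_lt => e e0; near=> t.
  have k0 : 0 <= 16 * c * d ^+ 2 by rewrite !mulr_ge0 ?exprn_ge0 ?(ltW d0).
  rewrite sub0r normrN /F mulNr normrN ger0_norm ?(divr_ge0 k0 (ltW (den0 t))) //.
  rewrite ltr_pdivrMr //.
  have tb : (16 * c * d / e) ^+ 2 < t by near: t; apply: nbhs_pinfty_gt; rewrite num_real.
  have b0 : 0 <= 16 * c * d / e by rewrite !mulr_ge0 ?invr_ge0 ?(ltW e0) ?(ltW d0).
  have : 16 * c * d / e < Num.sqrt t.
    by rewrite -(ger0_norm b0) -sqrtr_sqr ltr_sqrt // (le_lt_trans _ tb) // exprn_ge0.
  rewrite ltr_pdivrMr // => H.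
  have := ltr_pM2l d0 (16 * c * d) (Num.sqrt t * e); rewrite H; nra.
- by move=> t t1; have [] := dF t (lt_trans ltr01 t1).
- apply: cvg_at_right_filter.
  have [dd _] := dF 1 ltr01.
  by apply: differentiable_continuous; apply/derivable1_diffP.
- move=> t; rewrite in_itv/= andbT => t1.
  have [_ dd] := dF t (lt_trans ltr01 t1).
  by rewrite derive1E.
Unshelve. all: by end_near.
Qed.

(** If the sums were bounded by [A], then [w] would be dominated by [l] times a sum of logarithms
    [ln (t / nu i)]. Divided by [t^2], the majorant of each has integral at most [16 l / nu i], so
    the integral of [w t / t^2] would be at most [16 l (1 + |A|)], against quasianalyticity. *)
Lemma sum_inv_wquot_unbounded (R : realType) (w : R -> R) (l : R) :
  in_W w -> quasianalytic w -> 0 < l ->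
  forall A : R, exists n, A <= \sum_(i < n) (wquot w l i)^-1.
Proof.
move=> wW qw l0; apply: contrapT => /existsNP[A HA].
(* The extra term [nu 0 = 1] accounts for the summand [ln t] in [weight_le_sum_ln]. *)
pose nu (i : nat) : R := if i is i'.+1 then wquot w l i' else 1.
have nu0 i : 0 < nu i by case: i => [|i] /=; rewrite ?ltr01 ?wquot_gt0.
pose d (i : nat) : R := Num.sqrt (nu i)^-1.
have d0 i : 0 < d i by rewrite sqrtr_gt0 invr_gt0.
have dE i : d i ^+ 2 = (nu i)^-1 by rewrite sqr_sqrtr // invr_ge0 ltW.
have sumnu n : \sum_(0 <= i < n) (nu i)^-1 <= 1 + `|A|.
  case: n => [|n]; first by rewrite big_geq // addr_ge0.
  rewrite big_nat_recl //= invr1 lerD2l big_mkord.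
  have [An|nA] := leP A (\sum_(i < n) (wquot w l i)^-1).
    by case: HA; exists n.
  exact: le_trans (ltW nA) (ler_norm A).
have l0' := ltW l0.
pose D : set R := `[1%R, +oo[%classic.
have mD : measurable D by exact: measurable_itv.
have mmaj i : measurable_fun D (fun t : R => (majorant l (d i) t)%:E : \bar R).
  apply/measurable_EFinP; apply: subspace_continuous_measurable_fun => //.
  apply: continuous_in_subspaceT => t; rewrite inE/D/= in_itv/= andbT => t1.
  by apply: continuous_majorant => //; exact: lt_le_trans t1.
have maj0 (i : nat) (t : R) : D t -> (0 <= (majorant l (d i) t)%:E)%E.
  by move=> _; rewrite lee_fin majorant_ge0 // ltW.
have : (\int[@lebesgue_measure R]_(t in D) ((w t / t ^+ 2)%:E) <=
    \int[@lebesgue_measure R]_(t in D) \sum_(0 <= i <oo) (majorant l (d i) t)%:E)%E.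
  apply: ge0_le_integral => //.
  - move=> t; rewrite /D /= in_itv/= andbT => t1.
    by rewrite lee_fin divr_ge0 ?exprn_ge0 ?weight_ge0 // (le_trans ler01 t1).
  - apply/measurable_EFinP; apply: subspace_continuous_measurable_fun => //.
    have [[cw _] _] := wW.
    have c1 : {within D, continuous w}.
      apply: (continuous_subspaceW _ cw) => u; rewrite /D /= !in_itv/= !andbT.
      exact: le_trans.
    have c2 : {within D, continuous (fun t : R => (t ^+ 2)^-1)}.
      apply: continuous_in_subspaceT => t; rewrite inE/D/= in_itv/= andbT => t1.
      apply: cvgV; first by rewrite gt_eqF // exprn_gt0 // (lt_le_trans ltr01).
      exact: exprn_continuous.
    by move=> t; exact: cvgM (c1 t) (c2 t).
  - apply: ge0_emeasurable_sum.
      by move=> k t Dt _; exact: maj0.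
    by move=> k _; exact: mmaj.
  - move=> t Dt; have t1 : 1 <= t by move: Dt; rewrite /D /= in_itv/= andbT.
    have t0 : 0 < t by exact: lt_le_trans t1.
    (* At a given [t] finitely many majorants suffice; [j] depends on [t], but the full series does
       not. *)
    have [j wj] := weight_le_sum_ln wW l0 t1.
    apply: le_trans (nneseries_lim_ge j.+1 _); last by move=> n _ _; exact: maj0.
    rewrite sumEFin lee_fin ler_pdivrMr ?exprn_gt0 // (le_trans wj) //.
    rewrite big_nat_recl // big_mkord mulrDl mulrDr mulr_sumr mulr_suml.
    apply: lerD; last first.
      apply: ler_sum => i _; apply: le_trans (ln_le_majorant l0' (d0 i.+1) t1).
      by rewrite dE /= [_^-1 * _]mulrC.
    apply: le_trans (ln_le_majorant l0' (d0 0%N) t1).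
    by rewrite dE /= invr1 mul1r.
rewrite qw leye_eq => /eqP; rewrite integral_nneseries //.
move=> E; suff : (\sum_(0 <= i <oo)
    \int[@lebesgue_measure R]_(t in D) (majorant l (d i) t)%:E <=
    (16 * l * (1 + `|A|))%:E)%E by rewrite E leye_eq.
apply: lime_le.
  by apply: is_cvg_nneseries => n _ _; apply: integral_ge0; exact: maj0.
apply: nearW => n; apply: (@le_trans _ _ (\sum_(0 <= i < n) (16 * l * (nu i)^-1)%:E)%E).
  apply: lee_sum => i _; rewrite integral_majorant // lee_fin -dE.
  rewrite ler_pdivrMr ?addr_gt0 // ler_peMr ?lerDl ?(ltW (d0 i)) //.
  by rewrite !mulr_ge0 ?exprn_ge0 ?(ltW (d0 i)).
by rewrite sumEFin lee_fin -mulr_sumr ler_wpM2l // mulr_ge0.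
Qed.

(** * Jets along a coordinate axis *)

(** One integer bounds [l], the inverse radius and the constant at once, so that [almost_germ] is an
    increasing countable union. *)
Definition almost_germ_at {R : realType} (w : R -> R) (m : nat) (u : nat -> R) : Prop :=
  almost_jet (wseq w m.+1%:R) (m.+1%:R^-1) m.+1%:R u.

Definition almost_germ {R : realType} (w : R -> R) (u : nat -> R) : Prop :=
  exists m, almost_germ_at w m u.

Lemma almost_jet_le (R : realType) (W W' : nat -> R) (a a' M M' : R) (u : nat -> R) :
  (forall n, 0 <= W n <= W' n) -> a' <= a -> 0 <= M -> M <= M' ->
  almost_jet W a M u -> almost_jet W' a' M' u.
Proof.
move=> WW' a'a M0 MM' uJ N eps eps0; have [F [dF bF FJ]] := uJ N eps eps0.
exists F; split => // n s /andP[s0 sa'].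
  by apply: dF; rewrite s0 (le_trans sa' a'a).
have /andP[W0 W1] := WW' n.
apply: (@le_trans _ _ (M * W n)); first by apply: bF; rewrite s0 (le_trans sa' a'a).
by rewrite ler_pM.
Qed.

Lemma almost_germ_at_le (R : realType) (w : R -> R) (m m' : nat) (u : nat -> R) :
  in_W w -> (m <= m')%N -> almost_germ_at w m u -> almost_germ_at w m' u.
Proof.
move=> wW mm'; apply: almost_jet_le => //.
- by move=> n; rewrite (ltW (wseq_gt0 _ _ _)) wseq_homo // ler_nat.
- by rewrite lef_pV2 ?posrE ?ltr0n // ler_nat.
- by rewrite ler_nat.
Qed.

Lemma almost_germ_lin (R : realType) (w : R -> R) (u v : nat -> R) (x y : R) :
  in_W w -> almost_germ w u -> almost_germ w v ->
  almost_germ w (fun n => x * u n + y * v n).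
Proof.
move=> wW [m1 H1] [m2 H2]; set m0 := maxn m1 m2.
have {}H1 := almost_germ_at_le wW (leq_maxl m1 m2) H1.
have {}H2 := almost_germ_at_le wW (leq_maxr m1 m2) H2.
(* The constant of the combined tower is multiplied by [c]; the summand 1 ensures [c >= 1], so the
   new index also exceeds [m0]. *)
pose c : R := `|x| + `|y| + 1.
have c1 : 1 <= c by rewrite lerDr addr_ge0.
have c0 : 0 < c by exact: lt_le_trans c1.
exists (Num.trunc (c * m0.+1%:R)).
have mc : c * m0.+1%:R <= (Num.trunc (c * m0.+1%:R)).+1%:R :> R.
  by rewrite ltW // truncnS_gt.
have mm0 : m0.+1%:R <= (Num.trunc (c * m0.+1%:R)).+1%:R :> R.
  by apply: le_trans mc; rewrite ler_peMl.
apply: (@almost_jet_le R (wseq w m0.+1%:R) _ (m0.+1%:R^-1) _ (c * m0.+1%:R)) => //.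
- by move=> n; rewrite (ltW (wseq_gt0 _ _ _)) wseq_homo.
- by rewrite lef_pV2 ?posrE ?ltr0n.
- by rewrite mulr_ge0 // ltW.
move=> N eps eps0.
have e0 : 0 < eps / c by rewrite divr_gt0.
have [F [dF bF FJ]] := H1 N _ e0; have [G [dG bG GJ]] := H2 N _ e0.
have comb (p q e : R) : `|p| <= e -> `|q| <= e -> `|x * p + y * q| <= c * e.
  move=> pe qe; apply: le_trans (ler_normD _ _) _; rewrite !normrM /c !mulrDl mul1r.
  have := ler_wpM2l (normr_ge0 x) pe; have := ler_wpM2l (normr_ge0 y) qe.
  have := le_trans (normr_ge0 p) pe; lra.
exists (fun n s => x * F n s + y * G n s); split.
- by move=> n s sa; apply: is_deriveD; apply: is_deriveZ; [exact: dF|exact: dG].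
- by move=> n s sa; rewrite -mulrA; apply: comb; [exact: bF|exact: bG].
- move=> n nN.
  have -> : x * F n 0 + y * G n 0 - n`!%:R * (x * u n + y * v n) =
    x * (F n 0 - n`!%:R * u n) + y * (G n 0 - n`!%:R * v n) by ring.
  have -> : eps = c * (eps / c) by rewrite mulrC divfK // gt_eqF.
  by apply: comb; [exact: FJ|exact: GJ].
Qed.

Lemma almost_germ_geometric (R : realType) (w : R -> R) (u : nat -> R) (n1 : nat) :
  in_W w -> quasianalytic w -> almost_germ w u -> (forall n, (n1 <= n)%N -> 0 <= u n) ->
  exists C D : R, [/\ 0 <= C, 1 <= D & forall n, (n1 <= n)%N -> u n <= C * D ^+ n].
Proof.
move=> wW qw [m um] u0.
exists (m.+1%:R * wseq w m.+1%:R n1), m.+1%:R; split.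
- by rewrite mulr_ge0 // ltW ?wseq_gt0.
- by rewrite ler1n.
move=> n n1n; rewrite -[X in _ * X ^+ _]invrK.
have m0 : 0 < m.+1%:R :> R by rewrite ltr0n.
apply: (@almost_jet_geometric R _ (wquot w m.+1%:R) _ _ u) => //.
- by rewrite invf_le1 // ler1n.
- by move=> j; exact: wseq_gt0.
- by move=> j; exact: wquot_gt0.
- by move=> i j; exact: wseq_le_wquot.
- exact: sum_inv_wquot_unbounded.
Qed.

Definition axis {r : nat} (i0 : 'I_r) (n : nat) : mindex r :=
  [ffun i => if i == i0 then n else 0%N].

Lemma mlen_axis (r : nat) (i0 : 'I_r) (n : nat) : mlen (axis i0 n) = n.
Proof.
rewrite /mlen (bigD1 i0) //= ffunE eqxx big1 ?addn0 // => i /negbTE ni.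
by rewrite ffunE ni.
Qed.

Lemma pdm_axis (R : realType) (r : nat) (i0 : 'I_r) (n : nat) (g : 'rV[R]_r -> R) :
  pdm (axis i0 n) g = pdseq (nseq n i0) g.
Proof.
have -> : pdseq (nseq n i0) g = iter n (pd i0) g by elim: n => //= n ->.
have H (s : seq 'I_r) : uniq s ->
    foldr (fun i h => iter (axis i0 n i) (@pd R r i) h) g s =
    if i0 \in s then iter n (pd i0) g else g.
  elim: s => //= i s IH /andP[iNs /IH ->]; rewrite in_cons ffunE eq_sym.
  by case: eqVneq => //= ->; rewrite (negbTE iNs).
by rewrite /pdm H ?enum_uniq // mem_enum.
Qed.

Lemma is_derive_along (R : realType) (r : nat) (v : 'rV[R]_r) (g : 'rV[R]_r -> R) (s : R) :
  derivable g (s *: v) v -> is_derive s 1 (fun t => g (t *: v)) ('D_v g (s *: v)).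
Proof.
have E : (fun h : R => h^-1 *: (g ((h *: 1 + s) *: v) - g (s *: v))) =
    (fun h : R => h^-1 *: (g (h *: v + s *: v) - g (s *: v))).
  by apply/funext => h; rewrite scalerDl /GRing.scale /= mulr1.
move=> dg; split; first by rewrite /derivable /= E.
by rewrite /derive /= E.
Qed.

(** Length [1 / (k + 1)] keeps the closed segment inside the open cube of half-width [1 / k], where
    class estimates on compact sets apply. *)
Lemma axis_in_cube (R : realType) (r : nat) (i0 : 'I_r) (k : nat) (s : R) : (0 < k)%N ->
  0 <= s <= k.+1%:R^-1 -> cube R r k (s *: ev R r i0).
Proof.
move=> k0 /andP[s0 sk] i; rewrite !mxE eqxx /=.
apply: (@le_lt_trans _ _ k.+1%:R^-1); last by rewrite ltf_pV2 ?posrE ?ltr0n // ltr_nat.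
rewrite normrM (ger0_norm s0); case: (i == i0); rewrite ?normr1 ?mulr1 //.
by rewrite normr0 mulr0 invr_ge0.
Qed.

Lemma smooth_bounded_almost_germ (R : realType) (r : nat) (i0 : 'I_r) (w : R -> R)
    (k : nat) (g : 'rV[R]_r -> R) (l M : R) (u : nat -> R) :
  in_W w -> (0 < k)%N -> smooth_on (cube R r k) g -> 0 < l ->
  (forall n (s : R), 0 <= s <= k.+1%:R^-1 ->
    `|pdm (axis i0 n) g (s *: ev R r i0)| <= M * wseq w l n) ->
  (forall n, pdm (axis i0 n) g 0 = n`!%:R * u n) -> almost_germ w u.
Proof.
move=> wW k0 sg l0 bg gu.
(* This sum dominates [k], [l] and [M] simultaneously. The derivatives along the axis serve as the
   tower for every [N] and [eps]. *)
pose m := (k + Num.trunc l + Num.trunc M)%N.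
have M0 : 0 <= M.
  have := bg 0%N 0; rewrite lexx invr_ge0 ler0n => /(_ isT)/(le_trans (normr_ge0 _)).
  by rewrite pmulr_lge0 ?wseq_gt0.
exists m; apply: (@almost_jet_le R (wseq w l) _ k.+1%:R^-1 _ M) => //.
- move=> n; rewrite (ltW (wseq_gt0 _ _ _)) wseq_homo //.
  by rewrite (le_trans (ltW (truncnS_gt _))) // ler_nat ltnS /m addnAC leq_addl.
- by rewrite lef_pV2 ?posrE ?ltr0n // ler_nat ltnS /m -addnA leq_addr.
- by rewrite (le_trans (ltW (truncnS_gt _))) // ler_nat ltnS leq_addl.
move=> N eps eps0; exists (fun n s => pdm (axis i0 n) g (s *: ev R r i0)); split.
- move=> n s sk; have [_ /(_ i0) dg] := sg (nseq n i0) _ (axis_in_cube i0 k0 sk).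
  rewrite !pdm_axis; exact: is_derive_along.
- by move=> n s sk; exact: bg.
- by move=> n _; rewrite scale0r gu subrr normr0 ltW.
Qed.

Lemma axis_segment_compact (R : realType) (r : nat) (i0 : 'I_r) (a : R) :
  compact [set s *: ev R r i0 | s in `[0, a]].
Proof.
apply: continuous_compact; last exact: segment_compact.
apply: continuous_subspaceT => s; exact: scalel_continuous.
Qed.

Lemma cabs_ge_Re (R : realType) (z : R[i]) : `|complex.Re z| <= cabs z.
Proof.
by case: z => x y; rewrite /cabs /= -sqrtr_sqr ler_wsqrtr // lerDl sqr_ge0.
Qed.

Lemma cabs_ge_Im (R : realType) (z : R[i]) : `|complex.Im z| <= cabs z.
Proof.
by case: z => x y; rewrite /cabs /= -sqrtr_sqr ler_wsqrtr // lerDr sqr_ge0.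
Qed.

Lemma jetR_almost_germ (R : realType) (r : nat) (i0 : 'I_r) (w : R -> R) (b : cseq R r) :
  in_W w -> jetR w r b ->
  almost_germ w (fun n => complex.Re (b (axis i0 n))) /\
  almost_germ w (fun n => complex.Im (b (axis i0 n))).
Proof.
move=> wW [k [k0 [f [[[sRe sIm] bf] ->]]]].
have [|l l0 [M HM]] := bf _ (@axis_segment_compact R r i0 k.+1%:R^-1).
  by move=> _ [s /= + <-]; rewrite in_itv => /axis_in_cube; exact.
have cE n : cpd (axis i0 n) f 0 = n`!%:R * jet f (axis i0 n).
  by rewrite /jet mlen_axis mulrC divfK // pnatr_eq0 -lt0n fact_gt0.
have bnd n (s : R) : 0 <= s <= k.+1%:R^-1 ->
    cabs (cpd (axis i0 n) f (s *: ev R r i0)) <= M * wseq w l n.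
  move=> sk; have := HM (axis i0 n) (s *: ev R r i0).
  by rewrite /wgt mlen_axis; apply; exists s => //=; rewrite in_itv.
have reM n z : complex.Re ((n%:R : R[i]) * z) = n%:R * complex.Re z.
  by rewrite !mulr_natl raddfMn.
have imM n z : complex.Im ((n%:R : R[i]) * z) = n%:R * complex.Im z.
  by rewrite !mulr_natl raddfMn.
split.
- apply: (smooth_bounded_almost_germ (i0 := i0) wW k0 sRe l0) => [n s sk|n].
    by apply: le_trans (bnd n s sk); exact: (cabs_ge_Re (cpd _ f _)).
  by rewrite -reM -cE.
- apply: (smooth_bounded_almost_germ (i0 := i0) wW k0 sIm l0) => [n s sk|n].
    by apply: le_trans (bnd n s sk); exact: (cabs_ge_Im (cpd _ f _)).
  by rewrite -imM -cE.
Qed.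

(** * Sequences of supergeometric growth *)

(** Infinitely many indices are enough, because the bound to be contradicted holds for all large
    [n]. *)
Definition supergeometric {R : realType} (v : nat -> R) : Prop :=
  forall (n1 : nat) (C D : R), 0 <= C -> 1 <= D ->
    exists2 n, (n1 <= n)%N & C * D ^+ n < v n.

(** The largest Taylor coefficients allowed by the weight sequence of [h] with [l = 1]. *)
Definition young_coef {R : realType} (h : R -> R) (n : nat) : R :=
  expR (youngc h n%:R) / n`!%:R.

Lemma young_coef_gt0 (R : realType) (h : R -> R) (n : nat) : 0 < young_coef h n.
Proof. by rewrite divr_gt0 ?expR_gt0 // ltr0n fact_gt0. Qed.

Lemma fact_leq_expn (n : nat) : (n`! <= n ^ n)%N.
Proof.
suff H k : (k <= n)%N -> (k`! <= n ^ k)%N by exact: H.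
by elim: k => // k IH kn; rewrite factS expnS leq_mul // IH // ltnW.
Qed.

(* If [young_coef h n <= C D^n] for all [n], then taking [n] close to [t / (e D)]
   in [t^n exp (- h t) <= n! C D^n] gives [h t >= t / (e D) - const]. *)
Lemma young_coef_supergeometric (R : realType) (h : R -> R) :
  (forall x : R, exists c, forall y, 0 <= y -> x * y - h (expR y) <= c) ->
  liminf_over_id_zero h -> supergeometric (young_coef h).
Proof.
move=> hub hlim n1 C D C0 D1; apply: contrapT => H.
have {}H n : (n1 <= n)%N -> young_coef h n <= C * D ^+ n.
  by move=> n1n; rewrite leNgt; apply/negP => nH; apply: H; exists n.
have D0 : 0 < D by exact: lt_le_trans D1.
(* The finite sum extends the bound to the indices below [n1]; the summand 1 makes [C'] positive, so
   that [ln C'] is meaningful. *)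
pose C' := C + 1 + \sum_(i < n1) young_coef h i.
have S0 : 0 <= \sum_(i < n1) young_coef h i.
  by rewrite sumr_ge0 // => i _; rewrite ltW // young_coef_gt0.
have C'0 : 0 < C' by rewrite /C'; lra.
have {}H n : young_coef h n <= C' * D ^+ n.
  have [/H n1n|nn1] := leqP n1 n.
    by apply: (le_trans n1n); rewrite ler_wpM2r ?exprn_ge0 ?(ltW D0) // /C'; lra.
  apply: (@le_trans _ _ C'); last by rewrite ler_peMr ?(ltW C'0) // exprn_ege1.
  have : young_coef h n <= \sum_(i < n1) young_coef h i.
    rewrite (bigD1 (Ordinal nn1)) //= lerDl sumr_ge0 // => i _.
    by rewrite ltW // young_coef_gt0.
  rewrite /C'; lra.
pose E : R := expR 1 * D.
have E0 : 0 < E by rewrite mulr_gt0 ?expR_gt0.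
have lower t : 1 <= t -> t / E <= h t + ln C' + 1.
  move=> t1; have t0 : 0 < t by exact: lt_le_trans t1.
  (* Then [n E <= t], and [n! <= n^n] gives [n! (e D)^n <= t^n]: the factor [e^n] is the gain. *)
  pose n := Num.trunc (t / E).
  have /andP[nt tn] : n%:R <= t / E < n.+1%:R.
    by apply: truncn_itv; rewrite divr_ge0 ?ltW.
  suff : n%:R <= h t + ln C' by move: tn; rewrite -natr1; lra.
  have [c hc] := hub n%:R.
  have := youngc_ub hc (ln_ge0 t1); rewrite lnK ?posrE //.
  have : youngc h n%:R <= n%:R * ln t - n%:R + ln C'.
    have nf : 0 < n`!%:R :> R by rewrite ltr0n fact_gt0.
    have := H n; rewrite /young_coef ler_pdivrMr // => {}H.
    rewrite -ler_expR (le_trans H) // expRD lnK ?posrE //.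
    rewrite [leRHS]mulrC -mulrA ler_pM2l // expRB expRM_natl lnK ?posrE //.
    have -> : expR n%:R = expR 1 ^+ n :> R by rewrite -expRM_natl mulr1.
    rewrite ler_pdivlMr ?exprn_gt0 ?expR_gt0 //.
    rewrite mulrC mulrA -exprMn -/E.
    apply: (@le_trans _ _ (E ^+ n * n%:R ^+ n)).
      rewrite ler_wpM2l ?exprn_ge0 ?(ltW E0) // -natrX ler_nat.
      exact: fact_leq_expn.
    rewrite -exprMn; apply: lerXn2r; rewrite ?nnegrE ?(ltW t0) //.
      by rewrite mulr_ge0 // ltW.
    by rewrite mulrC -ler_pdivlMr.
  lra.
(* Beyond [T] the constant [1 + |ln C'|] is at most [t / (2 E)], so the lower bound contradicts
   [h t < t / (2 E)]. *)
pose T := Num.max 1 (2 * E * (1 + `|ln C'|)).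
have [|t [Tt [t0 ht]]] := hlim (2 * E)^-1 T; first by rewrite invr_gt0 mulr_gt0.
have t1 : 1 <= t by rewrite (le_trans _ Tt) // le_max lexx.
have t2 : 2 * E * (1 + `|ln C'|) <= t by rewrite (le_trans _ Tt) // le_max lexx orbT.
have := lower t t1; have := ler_norm (ln C').
move: ht; rewrite ltr_pdivrMr // => ht.
have : 1 + `|ln C'| <= t / (2 * E) by rewrite ler_pdivlMr ?mulr_gt0 // mulrC.
have -> : t / E = 2 * (t / (2 * E)) by field; rewrite gt_eqF.
move: ht; rewrite [_^-1 * t]mulrC; lra.
Qed.

(** Young conjugation reverses inequalities, and the conjugate of [w / l] at [n] is
    [youngc w (l n) / l]. *)
Lemma young_coef_le (R : realType) (w h : R -> R) (l c : R) (n : nat) :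
  in_W w -> 0 < l -> (forall t, 1 <= t -> w t / l <= h t + c) ->
  young_coef h n * n`!%:R <= expR c * wseq w l n.
Proof.
move=> wW l0 wh; rewrite divfK ?pnatr_eq0 -?lt0n ?fact_gt0 // -expRD ler_expR.
apply: youngc_le => y y0.
have := wh (expR y); rewrite -[X in X <= _ -> _]expR0 ler_expR => /(_ y0).
have := young_ge (l * n%:R) wW y0.
rewrite -(@ler_pM2r _ l^-1) ?invr_gt0 // mulrBl.
have -> : l * n%:R * y / l = n%:R * y by field; rewrite gt_eqF.
lra.
Qed.

Lemma roumieu_supergeometric (R : realType) (w : R -> R) :
  in_W w -> liminf_over_id_zero w ->
  exists v : nat -> R, [/\ forall n, 0 <= v n, supergeometric v &
    exists M, forall n, v n * n`!%:R <= M * wseq w 1 n].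
Proof.
move=> wW wlim; exists (young_coef w); split.
- by move=> n; rewrite ltW // young_coef_gt0.
- by apply: young_coef_supergeometric => // x; exact: young_has_ub.
- exists (expR 0) => n; apply: young_coef_le => // t _.
  by rewrite divr1 addr0.
Qed.

(* The geometric mean [sqrt (t * w t)] lies strictly between [w] and [t]. *)
Lemma beurling_supergeometric (R : realType) (w : R -> R) :
  in_W w -> small_o_id w ->
  exists v : nat -> R, [/\ forall n, 0 <= v n, supergeometric v &
    forall l, 0 < l -> exists M, forall n, v n * n`!%:R <= M * wseq w l n].
Proof.
move=> wW wo; pose h t := Num.sqrt (t * w t).
have wh (l : R) : 0 < l -> exists c, forall t, 1 <= t -> w t / l <= h t + c.
  (* From [w t <= l^2 t] follows [(w t)^2 <= l^2 t w t], that is [w t / l <= h t]. Smaller [t] are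
     absorbed in the constant by monotonicity of [w]. *)
  move=> l0; have [|T HT] := wo (l ^+ 2); first by rewrite exprn_gt0.
  have T0 : 0 <= Num.max T 1 by rewrite le_max ler01 orbT.
  exists (w (Num.max T 1) / l) => t t1.
  have t0 : 0 <= t by exact: le_trans t1.
  have w0 : 0 <= w t by rewrite weight_ge0.
  have [tT|Tt] := leP t (Num.max T 1).
    rewrite (@le_trans _ _ (w (Num.max T 1) / l)) ?lerDr ?sqrtr_ge0 //.
    by rewrite ler_pM2r ?invr_gt0 // weight_le.
  have {}Tt : T <= t by rewrite (le_trans _ (ltW Tt)) // le_max lexx.
  have := HT t Tt; rewrite ger0_norm // => wt.
  rewrite (@le_trans _ _ (h t)) ?lerDl ?(divr_ge0 (weight_ge0 wW T0) (ltW l0)) //.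
  rewrite ler_pdivrMr // -[leLHS](ger0_norm w0) -sqrtr_sqr.
  rewrite -[l](ger0_norm (ltW l0)) -[`|l|]sqrtr_sqr -sqrtrM ?mulr_ge0 //.
  rewrite ler_wsqrtr //; nra.
exists (young_coef h); split.
- by move=> n; rewrite ltW // young_coef_gt0.
- apply: young_coef_supergeometric => [x|eps T e0].
    have [c hc] := wh 1 ltr01; have [c' hc'] := young_has_ub x wW.
    exists (c' + c) => y y0; have := hc' y y0.
    have := hc (expR y); rewrite -[X in X <= _ -> _]expR0 ler_expR divr1 => /(_ y0).
    lra.
  have [|T' HT'] := wo ((eps / 2) ^+ 2); first by rewrite exprn_gt0 // divr_gt0.
  pose t := Num.max 1 (Num.max T T').
  have t1 : 1 <= t by rewrite le_max lexx.
  have t0 : 0 < t by exact: lt_le_trans t1.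
  exists t; split; first by rewrite !le_max lexx !orbT.
  split => //; have := HT' t; rewrite !le_max lexx !orbT => /(_ isT).
  rewrite ger0_norm ?(weight_ge0 wW (ltW t0)) // => wt.
  apply: (@le_lt_trans _ _ (eps / 2)); last by lra.
  rewrite ler_pdivrMr //.
  have et : 0 <= eps / 2 * t by rewrite mulr_ge0 ?(ltW t0) //; lra.
  rewrite -[leRHS](ger0_norm et) -sqrtr_sqr ler_wsqrtr // exprMn.
  rewrite [t ^+ 2]expr2 mulrA mulrC ler_wpM2r // ltW //.
- move=> l l0; have [c hc] := wh l l0.
  by exists (expR c) => n; apply: young_coef_le.
Qed.

(** * Multiples of a supergeometric sequence by polynomials in [2^-n], and lineability *)

Definition half_pow (R : realType) (n : nat) : R := 2^-1 ^+ n.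

Lemma half_pow_gt0 (R : realType) (n : nat) : 0 < half_pow R n.
Proof. by rewrite exprn_gt0 // invr_gt0. Qed.

Lemma half_pow_le1 (R : realType) (n : nat) : half_pow R n <= 1.
Proof. by rewrite exprn_ile1 // ?invr_ge0 // invf_le1 // ler1n. Qed.

Lemma half_pow_small (R : realType) (e : R) : 0 < e ->
  exists n1, forall n, (n1 <= n)%N -> half_pow R n <= e.
Proof.
move=> e0; exists (Num.trunc e^-1) => n nn.
rewrite /half_pow exprVn -[leRHS]invrK lef_pV2 ?posrE ?exprn_gt0 ?invr_gt0 //.
rewrite (le_trans (ltW (truncnS_gt _))) // -natrX ler_nat.
by rewrite (leq_ltn_trans nn) // ltn_expl.
Qed.

Lemma Re_realM (R : realType) (x : R) (z : R[i]) :
  complex.Re (x%:C%C * z) = x * complex.Re z.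
Proof. by case: z => a b /=; rewrite mul0r subr0. Qed.

Lemma Im_realM (R : realType) (x : R) (z : R[i]) :
  complex.Im (x%:C%C * z) = x * complex.Im z.
Proof. by case: z => a b /=; rewrite mul0r addr0. Qed.

Lemma cabsM (R : realType) (y z : R[i]) : cabs (y * z) = cabs y * cabs z.
Proof. exact: Normc.normcM. Qed.

Lemma cabs_ge0 (R : realType) (z : R[i]) : 0 <= cabs z.
Proof. by apply: le_trans (cabs_ge_Re z). Qed.

Lemma cabs_real (R : realType) (x : R) : cabs x%:C%C = `|x|.
Proof. by rewrite /cabs /= expr0n /= addr0 sqrtr_sqr. Qed.

Lemma cabsD (R : realType) (y z : R[i]) : cabs (y + z) <= cabs y + cabs z.
Proof.
rewrite -lecR rmorphD /=.
exact: (@ler_normD _ (R[i]) y z).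
Qed.

Lemma poly_half_pow_bounded (R : realType) (p : {poly R[i]}) :
  exists2 c : R, 0 <= c & forall n, cabs p.[(half_pow R n)%:C%C] <= c.
Proof.
elim/poly_ind: p => [|p a [c c0 IH]].
  by exists 0 => // n; rewrite horner0 (cabs_real 0) normr0.
exists (c + cabs a) => [|n]; first by rewrite addr_ge0 ?cabs_ge0.
rewrite hornerMXaddC (le_trans (cabsD _ _)) // lerD2r cabsM cabs_real.
rewrite (ger0_norm (ltW (half_pow_gt0 R n))).
by apply: le_trans (IH n); rewrite ler_piMr ?cabs_ge0 ?half_pow_le1.
Qed.

Definition part {R : realType} (re : bool) (z : R[i]) : R :=
  if re then complex.Re z else complex.Im z.

Lemma part_realM (R : realType) (re : bool) (x : R) (z : R[i]) :
  part re (x%:C%C * z) = x * part re z.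
Proof. by case: re; rewrite /= ?Re_realM ?Im_realM. Qed.

Lemma partD (R : realType) (re : bool) (y z : R[i]) :
  part re (y + z) = part re y + part re z.
Proof. by case: re; case: y; case: z. Qed.

Lemma part_le_cabs (R : realType) (re : bool) (z : R[i]) : `|part re z| <= cabs z.
Proof. by case: re; [exact: cabs_ge_Re|exact: cabs_ge_Im]. Qed.

(** Write [p = X^k q] with [q.[0] != 0]. Near 0 a nonzero real or imaginary part of [q] keeps its
    sign, which [s] normalizes to be positive. *)
Lemma poly_half_pow_lower (R : realType) (p : {poly R[i]}) : p != 0 ->
  exists (re : bool) (s : R) (k n1 : nat) (delta : R), 0 < delta /\
    forall n, (n1 <= n)%N ->
      delta * half_pow R n ^+ k <= s * part re p.[(half_pow R n)%:C%C].
Proof.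
elim/poly_ind: p => [|p a IH]; first by rewrite eqxx.
have [->|a0] := eqVneq a 0.
  rewrite addr0 => pX; have [|re [s [k [n1 [delta [d0 H]]]]]] := IH.
    by apply: contraNneq pX => ->; rewrite mul0r.
  exists re, s, k.+1, n1, delta; split => // n /H.
  rewrite hornerMX mulrC [_ * (half_pow R n)%:C%C]mulrC part_realM exprSr => {}H.
  rewrite mulrA mulrCA mulrC ler_wpM2l ?(ltW (half_pow_gt0 R n)) //.
  by rewrite mulrC.
move=> _.
have [re are] : exists re, part re a != 0.
  apply: contrapT => H; case/negP: a0; apply/eqP.
  case: a H => x y H; congr (_ +i* _)%C; apply/eqP; apply: contrapT => /negP h; apply: H.
    by exists true.
  by exists false.
have [c c0 pc] := poly_half_pow_bounded p.
have A0 : 0 < `|part re a| by rewrite normr_gt0.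
(* Below this threshold the nonconstant part of the polynomial is at most half of [|part re a|]. *)
have [|n1 Hn1] := @half_pow_small R (`|part re a| / (2 * (c + 1))).
  by rewrite divr_gt0 // mulr_gt0 // ltr_wpDl.
exists re, (Num.sg (part re a)), 0%N, n1, (`|part re a| / 2); split; first by rewrite divr_gt0.
move=> n /Hn1 hn; rewrite expr0 mulr1 hornerMXaddC partD mulrDr -normrEsg.
rewrite [_ * (half_pow R n)%:C%C]mulrC part_realM.
set q := half_pow R n in hn *; set z := p.[_].
have q0 : 0 < q by exact: half_pow_gt0.
have : `|Num.sg (part re a) * (q * part re z)| <= `|part re a| / 2.
  rewrite normrM normr_sg -[part re a != 0]/(~~ _) are mul1r normrM gtr0_norm //.
  apply: (@le_trans _ _ (q * (c + 1))).
    rewrite ler_wpM2l ?(ltW q0) // (le_trans (part_le_cabs _ _)) //.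
    by rewrite (le_trans (pc n)) // lerDl.
  rewrite -ler_pdivlMr ?ltr_wpDl //; apply: (le_trans hn).
  by rewrite invfM mulrA.
rewrite ler_norml => /andP[+ _]; lra.
Qed.

(** Linear in [p], so the polynomials parametrize the vector space needed for lineability; [p = 1]
    gives the transverse direction for the other claims. *)
Definition axis_seq {R : realType} {r : nat} (i0 : 'I_r) (v : nat -> R)
    (p : {poly R[i]}) : cseq R r :=
  fun a => if a == axis i0 (mlen a)
           then (v (mlen a))%:C%C * p.[(half_pow R (mlen a))%:C%C] else 0.

Lemma axis_seq_axis (R : realType) (r : nat) (i0 : 'I_r) (v : nat -> R)
    (p : {poly R[i]}) (n : nat) :
  axis_seq i0 v p (axis i0 n) = (v n)%:C%C * p.[(half_pow R n)%:C%C].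
Proof. by rewrite /axis_seq mlen_axis eqxx. Qed.

Lemma axis_seqD (R : realType) (r : nat) (i0 : 'I_r) (v : nat -> R) (p q : {poly R[i]}) :
  sqadd (axis_seq i0 v p) (axis_seq i0 v q) = axis_seq i0 v (p + q).
Proof.
apply/funext => a; rewrite /sqadd /axis_seq; case: ifP => _; last by rewrite addr0.
by rewrite hornerD mulrDr.
Qed.

Lemma axis_seqZ (R : realType) (r : nat) (i0 : 'I_r) (v : nat -> R) (z : R[i])
    (p : {poly R[i]}) :
  sqscale z (axis_seq i0 v p) = axis_seq i0 v (z *: p).
Proof.
apply/funext => a; rewrite /sqscale /axis_seq; case: ifP => _; last by rewrite mulr0.
by rewrite hornerZ mulrCA.
Qed.

Lemma axis_seq0 (R : realType) (r : nat) (i0 : 'I_r) (v : nat -> R) :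
  axis_seq i0 v 0 = sqzero R r.
Proof.
by apply/funext => a; rewrite /axis_seq horner0 mulr0 if_same.
Qed.

Lemma axis_seq_bndl (R : realType) (w : R -> R) (l M : R) (r : nat) (i0 : 'I_r)
    (v : nat -> R) (p : {poly R[i]}) :
  (forall n, 0 <= v n) -> (forall n, v n * n`!%:R <= M * wseq w l n) ->
  bndl w l (axis_seq i0 v p).
Proof.
move=> v0 vM; have [c c0 pc] := poly_half_pow_bounded p.
have M0 : 0 <= M.
  have := vM 0%N; rewrite -(pmulr_lge0 _ (wseq_gt0 w l 0)) mulrC => /(le_trans _); apply.
  by rewrite mulr_ge0.
exists (c * M) => a; rewrite /wgt -/(wseq w l (mlen a)) -mulrA /axis_seq.
have W0 := ltW (wseq_gt0 w l (mlen a)).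
case: ifP => _; last by rewrite (cabs_real 0) normr0 mul0r !mulr_ge0.
rewrite cabsM cabs_real ger0_norm // mulrAC mulrC.
by rewrite ler_pM ?cabs_ge0 // mulr_ge0.
Qed.

(** A linear condition satisfied by all jets of the class; it treats the Roumieu and Beurling jets
    together. *)
Definition germ_like {R : realType} {r : nat} (i0 : 'I_r) (w : R -> R) (b : cseq R r) : Prop :=
  forall re, almost_germ w (fun n => part re (b (axis i0 n))).

Lemma jetR_germ_like (R : realType) (r : nat) (i0 : 'I_r) (w : R -> R) (b : cseq R r) :
  in_W w -> jetR w r b -> germ_like i0 w b.
Proof. by move=> wW /(jetR_almost_germ i0 wW)[H1 H2] []. Qed.

(** Up to the sign [s], one part of the coefficients is eventually at least
    [delta * v n * 2^(-k n)]. A geometric bound [C D^n] on it would give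
    [v n <= (C / delta) (2^k D)^n]. *)
Lemma axis_seq_not_germ_like (R : realType) (r : nat) (i0 : 'I_r) (w : R -> R)
    (v : nat -> R) (p : {poly R[i]}) :
  in_W w -> quasianalytic w -> (forall n, 0 <= v n) -> supergeometric v ->
  p != 0 -> ~ germ_like i0 w (axis_seq i0 v p).
Proof.
move=> wW qw v0 vs /poly_half_pow_lower[re [s [k [n1 [delta [d0 H]]]]]] /(_ re) G.
have {}G := almost_germ_lin s 0 wW G G.
have L n : (n1 <= n)%N -> v n * (delta * half_pow R n ^+ k) <=
    s * part re (axis_seq i0 v p (axis i0 n)) + 0 * part re (axis_seq i0 v p (axis i0 n)).
  move=> n1n; rewrite mul0r addr0 axis_seq_axis part_realM [leRHS]mulrCA.
  by rewrite ler_wpM2l // H.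
have [|C [D [C0 D1 B]]] := almost_germ_geometric (n1 := n1) wW qw G.
  move=> n /L; apply: le_trans.
  by rewrite !mulr_ge0 ?exprn_ge0 // ltW // half_pow_gt0.
have [||n n1n] := vs n1 (C / delta) (D * 2 ^+ k).
- by rewrite divr_ge0 // ltW.
- by rewrite mulr_ege1 // exprn_ege1 // ler1n.
apply/negP; rewrite -leNgt mulrAC ler_pdivlMr // exprMn mulrA.
rewrite exprAC -ler_pdivrMr ?exprn_gt0 //.
by apply: le_trans (le_trans (L n n1n) (B n n1n)); rewrite /half_pow !exprVn mulrA.
Qed.

Lemma germ_like_sub (R : realType) (r : nat) (i0 : 'I_r) (w : R -> R)
    (b c : cseq R r) (re : bool) (x y : R) : in_W w ->
  almost_germ w (fun n => part re (sqadd b (sqscale x%:C%C c) (axis i0 n))) ->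
  almost_germ w (fun n => part re (sqadd b (sqscale y%:C%C c) (axis i0 n))) ->
  x != y -> almost_germ w (fun n => part re (c (axis i0 n))).
Proof.
move=> wW Gx Gy xy; have xy0 : x - y != 0 by rewrite subr_eq0.
have := almost_germ_lin (x - y)^-1 (- (x - y)^-1) wW Gx Gy.
congr almost_germ; apply/funext => n.
rewrite /sqadd /sqscale !partD !part_realM; field.
exact: xy0.
Qed.

Lemma almost_germ0 (R : realType) (w : R -> R) : almost_germ w (fun=> 0).
Proof.
exists 0%N => N eps e0; exists (fun _ _ => 0); split.
- by move=> n s _; exact: is_derive_cst.
- by move=> n s _; rewrite normr0 mulr_ge0 // ltW // wseq_gt0.
- by move=> n _; rewrite mulr0 subrr normr0 ltW.
Qed.

Lemma supergeometric_not_almost_germ (R : realType) (w : R -> R) (v : nat -> R) :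
  in_W w -> quasianalytic w -> (forall n, 0 <= v n) -> supergeometric v ->
  ~ almost_germ w v.
Proof.
move=> wW qw v0 vs /(almost_germ_geometric (n1 := 0) wW qw)[//|C [D [C0 D1 B]]].
by have [n _] := vs 0%N C D C0 D1; apply/negP; rewrite -leNgt B.
Qed.

Lemma jetB_sub_jetR (R : realType) (w : R -> R) (r : nat) : jetB w r `<=` jetR w r.
Proof.
move=> b [k [k0 [f [[fs fB] ->]]]]; exists k; split => //; exists f; split => //.
by split => // K cK KU; exists 1; [exact: ltr01|exact: fB ltr01].
Qed.

(** Linear independence comes from the same fact as avoidance of [J]: the zero sequence is
    [germ_like], so a vanishing [axis_seq i0 v p] forces [p = 0]. *)
Lemma lineable_axis_seq (R : realType) (r : nat) (i0 : 'I_r) (w : R -> R)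
    (v : nat -> R) (X J : set (cseq R r)) :
  in_W w -> quasianalytic w -> (forall n, 0 <= v n) -> supergeometric v ->
  (forall p, X (axis_seq i0 v p)) -> J `<=` germ_like i0 w -> lineable (X `\` J).
Proof.
move=> wW qw v0 vs Xv Jg.
exists [set axis_seq i0 v p | p in [set: {poly R[i]}]]; split; last split; last split; last split.
- by exists 0 => //; rewrite axis_seq0.
- by move=> _ _ [p _ <-] [q _ <-]; exists (p + q) => //; rewrite axis_seqD.
- by move=> z _ [p _ <-]; exists (z *: p) => //; rewrite axis_seqZ.
- move=> _ [p _ <-]; have [->|p0] := eqVneq p 0; first by right; rewrite axis_seq0.
  by left; split => // /Jg; exact: axis_seq_not_germ_like.
exists (fun n => axis_seq i0 v 'X^n); split => [n|n z Hz i iltn]; first by exists 'X^n.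
pose p := \poly_(j < n) z j.
have p0 : p = 0.
  apply/eqP; apply: contrapT => /negP /(axis_seq_not_germ_like (i0 := i0) wW qw v0 vs); apply.
  rewrite (_ : axis_seq i0 v p = sqzero R r).
    by case; exact: almost_germ0.
  apply/funext => a; rewrite -[RHS](Hz a) /axis_seq; case: ifP => _; last first.
    by rewrite big1 // => j _; rewrite mulr0.
  rewrite horner_poly mulr_sumr; apply: eq_bigr => j _.
  by rewrite hornerXn mulrCA.
by have := coef_poly n z i; rewrite iltn -/p p0 coef0.
Qed.

(** * Meagerness, density and Haar-nullness *)

Lemma scale_small (R : realType) (r : nat) (w : R -> R) (l eps : R) (c : cseq R r) :
  bndl w l c -> 0 < eps -> exists2 t0 : R, 0 < t0 & forall t : R, `|t| <= t0 ->
    forall a, cabs (sqscale t%:C%C c a) * (mlen a)`!%:R <= eps * wgt w l a.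
Proof.
move=> [M HM] e0; have M0 : 0 < `|M| + 1 by rewrite ltr_wpDl.
exists (eps / (`|M| + 1)) => [|t tt a]; first by rewrite divr_gt0.
have W0 : 0 < wgt w l a by exact: expR_gt0.
rewrite /sqscale cabsM cabs_real -mulrA.
apply: (@le_trans _ _ (eps / (`|M| + 1) * ((`|M| + 1) * wgt w l a))); last first.
  by rewrite mulrA divfK // gt_eqF.
rewrite ler_pM // ?mulr_ge0 ?cabs_ge0 // (le_trans (HM a)) // ler_wpM2r ?(ltW W0) //.
by have := ler_norm M; lra.
Qed.

Lemma scale_small_seq (R : realType) (r : nat) (w : R -> R) (s : seq R) (eps : R)
    (c : cseq R r) :
  LamB w r c -> all (fun l => 0 < l) s -> 0 < eps ->
  exists2 t0 : R, 0 < t0 & forall t : R, `|t| <= t0 -> forall l, l \in s ->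
    forall a, cabs (sqscale t%:C%C c a) * (mlen a)`!%:R <= eps * wgt w l a.
Proof.
move=> Bc + e0; elim: s => [|l s IH] /=; first by exists 1.
move=> /andP[l0 /IH[t0 t00 H0]].
have [t1 t10 H1] := scale_small (Bc l l0) e0.
exists (Num.min t0 t1) => [|t]; first by rewrite lt_min t00 t10.
rewrite le_min => /andP[tt0 tt1] l'; rewrite in_cons => /orP[/eqP ->|l's] a.
  exact: H1.
exact: H0.
Qed.

Lemma LamB_line (R : realType) (r : nat) (w : R -> R) (b c : cseq R r) (t : R) :
  LamB w r b -> LamB w r c -> LamB w r (sqadd b (sqscale t%:C%C c)).
Proof.
move=> Bb Bc l l0; have [M HM] := Bb l l0; have [N HN] := Bc l l0.
exists (M + `|t| * N) => a; rewrite mulrDl.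
apply: le_trans (ler_wpM2r (ler0n _ _) (cabsD _ _)) _.
rewrite mulrDl lerD // /sqscale cabsM cabs_real -!mulrA ler_wpM2l //.
Qed.

Lemma LamB0 (R : realType) (r : nat) (w : R -> R) : LamB w r (sqzero R r).
Proof. by move=> l l0; exists 0 => a; rewrite (cabs_real 0) normr0 !mul0r. Qed.

Lemma openB_line (R : realType) (r : nat) (w : R -> R) (U : set (cseq R r))
    (b c : cseq R r) (t : R) :
  openB w r U -> LamB w r b -> LamB w r c -> U (sqadd b (sqscale t%:C%C c)) ->
  exists2 t0 : R, 0 < t0 & forall t' : R, `|t' - t| <= t0 ->
    U (sqadd b (sqscale t'%:C%C c)).
Proof.
move=> [_ oU] Bb Bc /oU[s [s0 [eps e0 H]]].
have [t0 t00 Ht] := scale_small_seq Bc s0 e0.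
exists t0 => // t' tt'; apply: H; first exact: LamB_line.
move=> l ls a; have := Ht _ tt' l ls a.
by rewrite /sqadd /sqscale opprD addrACA subrr add0r -mulrBl -rmorphB.
Qed.

Definition germ_layer {R : realType} (w sigma : R -> R) {r : nat} (i0 : 'I_r) (m : nat) :
    set (cseq R r) :=
  LamB w r `&` [set b | almost_germ_at sigma m (fun n => complex.Re (b (axis i0 n)))].

(** If [b] is not in the layer, some [N] and [eps] admit no tower. Moving the first [N + 1]
    coefficients by so little that the derivatives change by at most [eps / 2] preserves this
    failure for [eps / 2], and one seminorm controls such a move. *)
Lemma germ_layer_closed (R : realType) (w sigma : R -> R) (r : nat) (i0 : 'I_r) (m : nat) :
  openB w r (LamB w r `\` germ_layer w sigma i0 m).
Proof.
split=> [b []//|b [Bb nb]].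
have [N [eps [e0 nF]]] : exists N (eps : R), 0 < eps /\ ~ exists F : nat -> R -> R,
    [/\ derivative_tower m.+1%:R^-1 F, bounded_tower (wseq sigma m.+1%:R) m.+1%:R^-1 m.+1%:R F &
        forall n, (n <= N)%N -> `|F n 0 - n`!%:R * complex.Re (b (axis i0 n))| <= eps].
  apply: contrapT => H; apply: nb; split => // N eps e0.
  by apply: contrapT => nF; apply: H; exists N, eps.
have [|e e1 He] := @ex_pos_lower_bound R (fun j => eps / 2 / wseq w 1 j) N.
  by move=> j; rewrite !divr_gt0 ?wseq_gt0.
exists [:: 1]; split; first by rewrite /= ltr01.
exists e => // c Bc cb; split => // -[_ Gc]; apply: nF.
have [|F [dF bF FJ]] := Gc N (eps / 2); first by rewrite divr_gt0.
exists F; split => // n nN.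
have := cb 1 (mem_head _ _) (axis i0 n); rewrite /wgt mlen_axis -/(wseq w 1 n) => cbn.
have h1 : `|n`!%:R * (complex.Re (c (axis i0 n)) - complex.Re (b (axis i0 n)))| <= eps / 2.
  rewrite normrM normr_nat mulrC.
  apply: (@le_trans _ _ (e * wseq w 1 n)); last by rewrite -ler_pdivlMr ?wseq_gt0 ?He.
  apply: le_trans cbn; rewrite ler_wpM2r //.
  apply: le_trans (cabs_ge_Re _); rewrite le_eqVlt; apply/orP; left; apply/eqP; congr `|_|.
  by case: (c _) => ? ?; case: (b _) => ? ?.
have := FJ n nN; have -> : F n 0 - n`!%:R * complex.Re (b (axis i0 n)) =
    (F n 0 - n`!%:R * complex.Re (c (axis i0 n))) +
    n`!%:R * (complex.Re (c (axis i0 n)) - complex.Re (b (axis i0 n))) by ring.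
by move=> h2; apply: le_trans (ler_normD _ _) _; lra.
Qed.

Lemma jetR_sub_layers (R : realType) (w sigma : R -> R) (r : nat) (i0 : 'I_r) :
  in_W sigma -> jetR sigma r `&` LamB w r `<=` \bigcup_m germ_layer w sigma i0 m.
Proof.
move=> sW b [/(jetR_almost_germ i0 sW)[[m Hm] _] Bb].
by exists m.
Qed.

(** Two distinct points would have [v] as a difference quotient, which is not an [almost_germ]. A
    line in this direction thus meets the subspace at most once; meagerness, density and
    Haar-nullness all rest on this. *)
Lemma almost_germ_line_unique (R : realType) (sigma : R -> R) (r : nat) (i0 : 'I_r) (v : nat -> R)
    (b : cseq R r) (x y : R) :
  in_W sigma -> quasianalytic sigma -> (forall n, 0 <= v n) -> supergeometric v ->
  almost_germ sigma (fun n => complex.Re (sqadd b (sqscale x%:C%C (axis_seq i0 v 1)) (axis i0 n))) ->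
  almost_germ sigma (fun n => complex.Re (sqadd b (sqscale y%:C%C (axis_seq i0 v 1)) (axis i0 n))) ->
  x = y.
Proof.
move=> sW qs v0 vs Gx Gy; apply/eqP; apply: contrapT => /negP xy.
apply: (supergeometric_not_almost_germ sW qs v0 vs).
have := @germ_like_sub R r i0 sigma b _ true x y sW Gx Gy xy.
congr almost_germ; apply/funext => n.
by rewrite axis_seq_axis part_realM hornerC /= mulr1.
Qed.

(** Layers are closed, and from any point of a layer every nonzero move in the direction of [v]
    leaves it, so their complements are open and dense. *)
Lemma meager_layers (R : realType) (w sigma : R -> R) (r : nat) (i0 : 'I_r) (v : nat -> R) :
  in_W sigma -> quasianalytic sigma -> (forall n, 0 <= v n) -> supergeometric v ->
  LamB w r (axis_seq i0 v 1) ->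
  meagerIn (openB w r) (LamB w r) (jetR sigma r `&` LamB w r).
Proof.
move=> sW qs v0 vs Bv; exists (fun m => LamB w r `\` germ_layer w sigma i0 m); split.
  move=> m; split; first exact: germ_layer_closed.
  move=> U oU [b Ub]; have Bb : LamB w r b by apply: oU.1.
  have b0 : sqadd b (sqscale 0%:C%C (axis_seq i0 v 1)) = b.
    by apply/funext => a; rewrite /sqadd /sqscale mul0r addr0.
  have [|t0 t00 Ht] := @openB_line R r w U b (axis_seq i0 v 1) 0 oU Bb Bv.
    by rewrite b0.
  have [nG|G] := pselect ((LamB w r `\` germ_layer w sigma i0 m) b); first by exists b.
  have Ut : U (sqadd b (sqscale t0%:C%C (axis_seq i0 v 1))).
    by apply: Ht; rewrite subr0 gtr0_norm.
  exists (sqadd b (sqscale t0%:C%C (axis_seq i0 v 1))); split => //.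
  split; first exact: LamB_line.
  move=> [_ G1]; have G0 : germ_layer w sigma i0 m b by apply: contrapT => nG; apply: G.
  have E : t0 = 0.
    apply: (@almost_germ_line_unique R sigma r i0 v b) => //; first by exists m.
    by rewrite b0; exists m; case: G0.
  by rewrite E ltxx in t00.
move=> b H; have [Bb _] := H 0%N I; split => //.
move=> /(jetR_sub_layers i0 sW)[m _ Gm].
by have [_] := H m I.
Qed.

(** The direction lies in the step [l = 1], so a small multiple of it lies in the ball of that step
    contained in the neighbourhood. *)
Lemma denseR_compl (R : realType) (w sigma : R -> R) (r : nat) (i0 : 'I_r) (v : nat -> R)
    (J : set (cseq R r)) :
  in_W sigma -> quasianalytic sigma -> (forall n, 0 <= v n) -> supergeometric v ->
  bndl w 1 (axis_seq i0 v 1) -> J `<=` germ_like i0 sigma ->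
  denseIn (openR w r) (LamR w r `\` J).
Proof.
move=> sW qs v0 vs Bv Jg U [UL oU] [b Ub].
have [nJ|] := pselect ((LamR w r `\` J) b); first by exists b.
move=> Jb; have {}Jb : J b by apply: contrapT => nJ; apply: Jb; split => //; exact: UL.
have [W [WU [_ /(_ 1 ltr01)[eps e0 We]]]] := oU b Ub.
have [t0 t00 Ht] := scale_small Bv e0.
have Ut : U (sqadd b (sqscale t0%:C%C (axis_seq i0 v 1))).
  by apply: WU; apply: We; apply: Ht; rewrite gtr0_norm.
exists (sqadd b (sqscale t0%:C%C (axis_seq i0 v 1))); split => //; split; first exact: UL.
move=> /Jg/(_ true) G1.
have E : t0 = 0.
  apply: (@almost_germ_line_unique R sigma r i0 v b) => //.
  rewrite (_ : sqadd b _ = b); first exact: (Jg _ Jb true).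
  by apply/funext => a; rewrite /sqadd /sqscale mul0r addr0.
by rewrite E ltxx in t00.
Qed.

(** * Haar-nullness by Lebesgue measure on a segment *)

Lemma sqadd0 (R : realType) (r : nat) (b : cseq R r) : sqadd (sqzero R r) b = b.
Proof. by apply/funext => a; rewrite /sqadd add0r. Qed.

Lemma sqscale_LamB (R : realType) (r : nat) (w : R -> R) (c : cseq R r) (t : R) :
  LamB w r c -> LamB w r (sqscale t%:C%C c).
Proof. by move=> Bc; rewrite -[sqscale _ _]sqadd0; apply: LamB_line => //; exact: LamB0. Qed.

Lemma ray_preimage_open (R : realType) (r : nat) (w : R -> R) (c : cseq R r)
    (U : set (cseq R r)) :
  LamB w r c -> openB w r U -> open [set t : R | U (sqscale t%:C%C c)].
Proof.
move=> Bc oU; rewrite openE => t /= Ut.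
have [|t0 t00 H] := @openB_line R r w U (sqzero R r) c t oU (@LamB0 R r w) Bc.
  by rewrite sqadd0.
exists t0 => //= t'; rewrite /ball /= distrC => /ltW /H.
by rewrite sqadd0.
Qed.

(** The sets with measurable preimage form a sigma-algebra containing the open sets; complements
    relative to [LamB w r] are harmless since the ray stays inside it. *)
Lemma ray_preimage_measurable (R : realType) (r : nat) (w : R -> R) (c : cseq R r)
    (E : set (cseq R r)) :
  LamB w r c -> <<s LamB w r, openB w r >> E ->
  measurable [set t : R | E (sqscale t%:C%C c)].
Proof.
move=> Bc; pose G := [set E | measurable [set t : R | E (sqscale t%:C%C c)]].
suff /(_ E) : <<s LamB w r, openB w r >> `<=` G by [].
apply: smallest_sub; last first.
  by move=> U oU; apply: open_measurable; exact: ray_preimage_open Bc oU.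
split.
- exact: measurable0.
- move=> A mA; rewrite /G /=.
  rewrite (_ : [set t : R | _] = ~` [set t : R | A (sqscale t%:C%C c)]).
    exact: measurableC.
  apply/seteqP; split => [t [_ nA] //|t nA]; split => //; exact: sqscale_LamB.
- move=> A mA; rewrite /G /=.
  rewrite (_ : [set t : R | _] = \bigcup_k [set t : R | A k (sqscale t%:C%C c)]).
    by apply: bigcup_measurable => k _; exact: mA.
  by apply/seteqP; split => t /= [k _ H]; exists k.
Qed.

Lemma ray_segment_compact (R : realType) (r : nat) (w : R -> R) (c : cseq R r) :
  LamB w r c -> compactIn (openB w r) [set sqscale t%:C%C c | t in `[0 : R, 1]].
Proof.
move=> Bc F FO KF.
(* Choosing a member of the cover for each parameter turns it into a cover of [[0, 1]] indexed by
   reals, to which compactness of the interval applies. *)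
have /choice[U HU] (t : R) : exists V : set (cseq R r), 0 <= t <= 1 ->
    F V /\ V (sqscale t%:C%C c).
  have [t01|nt] := pselect (0 <= t <= 1); last by exists set0.
  have [|V FV Vt] := KF (sqscale t%:C%C c); last by exists V.
  by exists t => //=; rewrite in_itv.
have := @segment_compact R 0 1; rewrite compact_cover.
move=> /(_ R `[0, 1]%classic (fun t => [set t' : R | U t (sqscale t'%:C%C c)])).
case.
- by move=> t; rewrite /= in_itv => /HU[FU _]; apply: (ray_preimage_open Bc); exact: FO.
- by move=> t t01; exists t => //=; apply: (HU t _).2; move: t01; rewrite /= in_itv.
move=> D sD cD; exists (size (finmap.enum_fset D)), (fun i => U (nth 0 (finmap.enum_fset D) i)).
split=> [i iD|_ [t t01 <-]].
  have /sD : nth 0 (finmap.enum_fset D) i \in finmap.enum_fset D by exact: mem_nth.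
  by rewrite in_setE /= in_itv => /HU[].
have [t' Dt' Ut'] := cD t t01; exists (index t' (finmap.enum_fset D)) => /=.
  by rewrite index_mem.
by rewrite nth_index.
Qed.

Lemma haar_null_layers (R : realType) (w sigma : R -> R) (r : nat) (i0 : 'I_r)
    (v : nat -> R) :
  in_W sigma -> quasianalytic sigma -> (forall n, 0 <= v n) -> supergeometric v ->
  LamB w r (axis_seq i0 v 1) ->
  haar_nullIn R (openB w r) (@sqadd R r) (LamB w r) (jetR sigma r `&` LamB w r).
Proof.
move=> sW qs v0 vs; set c := axis_seq i0 v 1 => Bc.
have [sX sC sU] := @smallest_sigma_algebra _ (LamB w r) (openB w r).
exists (\bigcup_m germ_layer w sigma i0 m); split.
  apply: sU => m.
  rewrite (_ : germ_layer _ _ _ _ = LamB w r `\` (LamB w r `\` germ_layer w sigma i0 m)).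
    by apply: sC; apply: sub_sigma_algebra; exact: germ_layer_closed.
  by rewrite setDD; apply/seteqP; split => [b [Bb Gb]|b []//]; do 2?split.
split; first exact: jetR_sub_layers.
pose P (E : set (cseq R r)) := [set t : R | E (sqscale t%:C%C c)].
have mP E : <<s LamB w r, openB w r >> E -> measurable (`[0, 1] `&` P E : set R).
  by move=> sE; apply: measurableI => //; exact: ray_preimage_measurable sE.
(* The image of Lebesgue measure on [[0, 1]] under [t] to [t c]. *)
exists (fun E => @lebesgue_measure R (`[0, 1] `&` P E)); split.
  by rewrite (_ : P set0 = set0) ?setI0 ?measure0.
split; first by [].
split.
  move=> F sF tF.
  have -> : `[0, 1] `&` P (\bigcup_n F n) = \bigcup_n (`[0, 1] `&` P (F n)).
    by rewrite -setI_bigcupr.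
  have := @measure_semi_sigma_additive _ _ _ (@lebesgue_measure R)
    (fun n => `[0, 1] `&` P (F n)).
  move=> /(_ (fun n => mP _ (sF n))) H.
  under eq_fun do rewrite -(big_mkord xpredT (fun k => lebesgue_measure (`[0, 1] `&` P (F k)))).
  apply: H; last by apply: bigcup_measurable => n _; exact: mP.
  apply/trivIsetP => i j _ _ ij; move/trivIsetP: tF => /(_ i j I I ij) Fij.
  apply/seteqP; split => // t [[_ Fi] [_ Fj]] /=.
  by have : (F i `&` F j) (sqscale t%:C%C c) by []; rewrite Fij.
have one E : (forall t : R, 0 <= t <= 1 -> E (sqscale t%:C%C c)) ->
    @lebesgue_measure R (`[0, 1] `&` P E) = 1%E.
  move=> H; rewrite (_ : _ `&` _ = `[0, 1]%classic).
    by rewrite lebesgue_measure_itv /= lte_fin ltr01 -EFinB subr0.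
  by apply/seteqP; split => [t []//|t t01]; split => //; apply: H; move: t01; rewrite /= in_itv.
split; first by apply: one => t _; exact: sqscale_LamB.
split.
  exists [set sqscale t%:C%C c | t in `[0 : R, 1]]; split; last split.
  - by move=> _ [t _ <-]; exact: sqscale_LamB.
  - exact: ray_segment_compact.
  - by apply: one => t t01; exists t => //=; rewrite in_itv.
move=> x Bx; set T := _ `&` _.
(* If [t c] lies in [x + B], then [- x + t c] lies in [B]; a line in direction [c] has at most one
   such point, so the preimage is null. *)
have T1 (s t : R) : T s -> T t -> s = t.
  move=> [_ [b [m _ Gb] eb]] [_ [b' [m' _ Gb'] eb']].
  have xE (q : R) (d : cseq R r) : sqadd x d = sqscale q%:C%C c ->
      sqadd (sqscale (-1)%:C%C x) (sqscale q%:C%C c) = d.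
    move=> <-; apply/funext => a; rewrite /sqadd /sqscale rmorphN rmorph1 mulN1r.
    by rewrite addrA addNr add0r.
  apply: (@almost_germ_line_unique R sigma r i0 v (sqscale (-1)%:C%C x)) => //.
    by rewrite (xE _ _ eb); exists m; case: Gb.
  by rewrite (xE _ _ eb'); exists m'; case: Gb'.
have [[t Tt]|/nonemptyPn ->] := pselect (T !=set0); last by rewrite measure0.
rewrite (_ : T = [set t]) ?lebesgue_measure_set1 //.
by apply/seteqP; split => [s Ts|s ->] //=; exact: T1.
Qed.

Theorem mainTheorem15 (R : realType) (r : nat) (sigma : R -> R) :
  (0 < r)%N -> in_W sigma -> quasianalytic sigma ->
  (* (1) *)
  (forall w : R -> R, in_W w -> quasianalytic w -> small_o_id w ->
     meagerIn (openB w r) (LamB w r) (jetR sigma r `&` LamB w r) /\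
     haar_nullIn R (openB w r) (@sqadd R r) (LamB w r) (jetR sigma r `&` LamB w r)) /\
  (* (2) *)
  (forall w : R -> R, in_W w -> quasianalytic w -> big_O_id w -> liminf_over_id_zero w ->
     denseIn (openR w r) (LamR w r `\` jetR sigma r) /\
     denseIn (openR w r) (LamR w r `\` jetB sigma r)) /\
  (* (3) *)
  (forall w : R -> R, in_W w -> quasianalytic w ->
     ((big_O_id w /\ liminf_over_id_zero w) ->
        lineable (LamR w r `\` jetR sigma r) /\ lineable (LamR w r `\` jetB sigma r)) /\
     (small_o_id w ->
        lineable (LamB w r `\` jetR sigma r) /\ lineable (LamB w r `\` jetB sigma r))).
Proof.
(* [0 < r] supplies the coordinate axis along which all jets are tested. *)
move=> r0 sW qs; pose i0 := Ordinal r0.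
have JR : jetR sigma r `<=` germ_like i0 sigma.
  by move=> b; exact: jetR_germ_like.
have JB : jetB sigma r `<=` germ_like i0 sigma.
  by move=> b /jetB_sub_jetR; exact: JR.
split; last split.
- move=> w wW _ /(beurling_supergeometric wW)[v [v0 vs vB]].
  have Bv : LamB w r (axis_seq i0 v 1).
    by move=> l /vB[M]; exact: axis_seq_bndl.
  by split; [exact: (meager_layers sW qs v0 vs Bv)|exact: (haar_null_layers sW qs v0 vs Bv)].
- move=> w wW _ _ /(roumieu_supergeometric wW)[v [v0 vs [M vM]]].
  have Bv : bndl w 1 (axis_seq i0 v 1) by exact: axis_seq_bndl vM.
  by split; [exact: (denseR_compl sW qs v0 vs Bv JR)|exact: (denseR_compl sW qs v0 vs Bv JB)].
move=> w wW _; split.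
  move=> [_ /(roumieu_supergeometric wW)[v [v0 vs [M vM]]]].
  have Rv p : LamR w r (axis_seq i0 v p).
    by exists 1; [exact: ltr01|exact: axis_seq_bndl vM].
  by split; [exact: (lineable_axis_seq sW qs v0 vs Rv JR)|exact: (lineable_axis_seq sW qs v0 vs Rv JB)].
move=> /(beurling_supergeometric wW)[v [v0 vs vB]].
have Bv p : LamB w r (axis_seq i0 v p).
  by move=> l /vB[M]; exact: axis_seq_bndl.
by split; [exact: (lineable_axis_seq sW qs v0 vs Bv JR)|exact: (lineable_axis_seq sW qs v0 vs Bv JB)].
Qed.
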